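(* For every positive integer $M$ and every $\alpha\in[0,2\pi)$, there exists an $\varepsilon_0>0$ such that for all $\varepsilon<\varepsilon_0$ there is an $H^1$-local minimizer $u_{\varepsilon,M}=\rho_{\varepsilon,M}e^{i\theta_{\varepsilon,M}}$ of $E_\varepsilon$ within the class $\mathcal{A}_\alpha$ such that $$\limsup_{\varepsilon\to0}\frac{\|\rho_{\varepsilon,M}-1\|_{L^\infty(0,1)}}{\varepsilon}<\infty,$$ $$\lim_{\varepsilon\to0}\theta_{\varepsilon,M}'=2\pi M+\alpha\quad\text{uniformly in }x\in[0,1],$$ and $$\lim_{\varepsilon\to0}E_\varepsilon(u_{\varepsilon,M})=\frac{L}{2}\left(2\pi(M-N)+\alpha\right)^2.$$
   Context: Fix a constant $L>0$ and a positive integer $N$; $\varepsilon$ always denotes a positive parameter. For $u=(u_1,u_2)\in H^1((0,1);\mathbb{R}^2)$ (identified with a complex-valued map when convenient) set $$E_\varepsilon(u)=\int_0^1 \frac{\varepsilon}{2}|u'|^2+\frac{1}{4\varepsilon}(|u|^2-1)^2+\frac{L}{2}(u_1u_2'-u_2u_1'-2\pi N)^2\,dx,$$ and $$\mathcal{A}_\alpha=\{u\in H^1((0,1);\mathbb{R}^2): u(0)=1,\ u(1)=e^{i\alpha}\}.$$ An $H^1$-local minimizer of $E_\varepsilon$ within $\mathcal{A}_\alpha$ is a $u\in\mathcal{A}_\alpha$ for which there is $r>0$ with $E_\varepsilon(u)\le E_\varepsilon(v)$ for all $v\in\mathcal{A}_\alpha$ with $\|v-u\|_{H^1}<r$. In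 the representation $u_{\varepsilon,M}=\rho_{\varepsilon,M}e^{i\theta_{\varepsilon,M}}$, $\rho_{\varepsilon,M}=|u_{\varepsilon,M}|$ and $\theta_{\varepsilon,M}$ is a real-valued $H^1$ function on $(0,1)$. *)

(* Defs.v *)
From HB Require Import structures.
From mathcomp Require Import all_boot all_order all_algebra.
From mathcomp Require Import all_classical all_reals all_analysis.

Set Implicit Arguments.
Unset Strict Implicit.
Unset Printing Implicit Defensive.

Import Order.TTheory GRing.Theory Num.Theory.
Import numFieldNormedType.Exports.

Local Open Scope classical_set_scope.
Local Open Scope ring_scope.

(* Functions on (0,1) are encoded as total functions on R; every notion below
   only depends on their values on [0,1]. *)

Definition L2_01 (R : realType) (f : R -> R) : Prop :=
  measurable_fun (`]0, 1[ : set R) f /\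
  (@lebesgue_measure R).-integrable (`]0, 1[ : set R) (fun x => (f x ^+ 2)%:E).

(* C^1_c((0,1)); as usual, testing against C^oo_c((0,1)) gives the same weak
   derivatives. *)
Definition test_function (R : realType) (phi : R -> R) : Prop :=
  [/\ forall x, derivable phi x 1,
      continuous (derive1 phi)
    & exists a b : R, [/\ 0 < a, b < 1 & forall x, x \notin `[a, b] -> phi x = 0]].

Definition is_weak_derivative (R : realType) (f g : R -> R) : Prop :=
  L2_01 g /\
  forall phi : R -> R, test_function phi ->
    \int[@lebesgue_measure R]_(x in `]0, 1[) (f x * derive1 phi x)
    = - \int[@lebesgue_measure R]_(x in `]0, 1[) (g x * phi x).

(* An element of H^1(0,1) is always given by its representative that is
   continuous on [0,1]; boundary values are those of this representative. *)
Definition H1_01 (R : realType) (f : R -> R) : Prop :=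
  {within `[0, 1], continuous f} /\ exists g, is_weak_derivative f g.

(* A representative of the weak derivative, which is unique up to a null set. *)
Definition weak_derivative (R : realType) (f : R -> R) : R -> R :=
  xget (fun=> 0) [set g | is_weak_derivative f g].

(* Maps into R^2 are functions into pairs, (a, b) standing for a + i b. Since
   the library norm on pairs is the max norm, Euclidean norms are written out. *)
Definition re_part (R : realType) (u : R -> R * R) : R -> R := fun x => (u x).1.
Definition im_part (R : realType) (u : R -> R * R) : R -> R := fun x => (u x).2.

Definition modulus (R : realType) (u : R -> R * R) : R -> R :=
  fun x => Num.sqrt (re_part u x ^+ 2 + im_part u x ^+ 2).

Definition H1_01_R2 (R : realType) (u : R -> R * R) : Prop :=
  H1_01 (re_part u) /\ H1_01 (im_part u).

Definition H1_norm (R : realType) (w : R -> R * R) : R :=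
  Num.sqrt (\int[@lebesgue_measure R]_(x in `]0, 1[)
    (re_part w x ^+ 2 + im_part w x ^+ 2
     + weak_derivative (re_part w) x ^+ 2
     + weak_derivative (im_part w) x ^+ 2)).

Definition energy (R : realType) (L : R) (N : nat) (eps : R)
    (u : R -> R * R) : R :=
  let u1 := re_part u in
  let u2 := im_part u in
  let du1 := weak_derivative u1 in
  let du2 := weak_derivative u2 in
  \int[@lebesgue_measure R]_(x in `]0, 1[)
    (eps / 2 * (du1 x ^+ 2 + du2 x ^+ 2)
     + 1 / (4 * eps) * (modulus u x ^+ 2 - 1) ^+ 2
     + L / 2 * (u1 x * du2 x - u2 x * du1 x - 2 * pi * N%:R) ^+ 2).

Definition admissible (R : realType) (alpha : R) (u : R -> R * R) : Prop :=
  [/\ H1_01_R2 u, u 0 = (1, 0) & u 1 = (cos alpha, sin alpha)].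

Definition H1_local_minimizer (R : realType) (L : R) (N : nat) (alpha eps : R)
    (u : R -> R * R) : Prop :=
  admissible alpha u /\
  exists2 r : R, 0 < r &
    forall v, admissible alpha v ->
      H1_norm (fun x => (re_part v x - re_part u x, im_part v x - im_part u x)) < r ->
      energy L N eps u <= energy L N eps v.

Definition Linfty_norm_01 (R : realType) (f : R -> R) : \bar R :=
  'N[@lebesgue_measure R]_(+oo%E) [EFin \o (f \_ `]0, 1[)].

(* Classical derivative at every point of [0,1], one-sided at 0 and 1. *)
Definition has_derivative_on_01 (R : realType) (f df : R -> R) : Prop :=
  forall x : R, x \in `[0, 1] ->
    (f y - f x) / (y - x) @[y --> within `[0, 1] x^'] --> df x.

(* Main.v *)
Require Import Defs.
From HB Require Import structures.
From mathcomp Require Import all_boot all_order all_algebra.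
From mathcomp Require Import all_classical all_reals all_analysis.
From mathcomp Require Import measurable_realfun ess_sup_inf ring lra.

Set Implicit Arguments.
Unset Strict Implicit.
Unset Printing Implicit Defensive.

Import Order.TTheory GRing.Theory Num.Theory.
Import numFieldNormedType.Exports.

Local Open Scope classical_set_scope.
Local Open Scope ring_scope.

(** In polar form u = r e^{i th}, with w = th', the energy is the integral of
    eps/2 r'^2 + V(r, w), where
      V(r, w) = eps/2 r^2 w^2 + (r^2 - 1)^2 / (4 eps) + L/2 (r^2 w - 2 pi N)^2.
    Near r = 1 and for bounded w, the second derivatives of V are about 2/eps in
    r and L in w, while the mixed one stays bounded; hence V lies above its
    tangent planes there when eps is small (polar_density_convex). So every
    critical point with r close to 1 and w bounded minimizes the energy among
    maps of the same winding that are close to it in the sup norm, a fortiori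
    among maps that are close in H^1. This holds for every winding M, and the
    theorem reduces to finding such a critical point with th 1 = beta, where
    beta = 2 pi M + alpha.

    Minimality is proved by calibration, which avoids lifting the competitor v
    to polar coordinates: the tangent inequality bounds the density of v below
    by that of u plus the derivative of eps r' (|v| - r) + C arg (e^{-i th} v),
    a function that vanishes at both ends (lemma calibration). Only a chain rule
    for absolutely continuous functions is needed (ac01_chain), together with the
    fact that functions with an L^2 weak derivative are absolutely continuous
    (weak_derivative_ac01).

    As for existence, the angular equation says that the derivative of V in w is
    a constant C; it determines w from r, and C is fixed by the total angle.
    Putting r = 1 + p, the radial equation becomes p'' = (2 / eps^2) (p + S(p)),
    p 0 = p 1 = 0, where S(p) is quadratic in p up to terms of size eps. The
    operator solving y'' = (2 / eps^2) (y + f), y 0 = y 1 = 0, has norm at most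
    1 in the sup norm (green_bound), while S has a small Lipschitz constant on a
    ball of radius K eps, so a fixed point exists there (EL_solution). It satisfies
    r - 1 = O(eps), r' = O(1) and w - beta = O(eps), which give the three
    limits. *)

(** * Continuous functions on the unit interval *)

Definition intg01 (R : realType) (f : R -> R) :=
  (@lebesgue_measure R).-integrable `[0, 1] (EFin \o f).

Definition cont01 (R : realType) (f : R -> R) := {within `[0, 1], continuous f}.

Section Interval.
Context {R : realType}.
Implicit Types (f g : R -> R) (x y : R).

Lemma cont01P f : cont01 f <->
  forall x, 0 <= x <= 1 -> forall e, 0 < e -> exists2 d, 0 < d &
    forall y, 0 <= y <= 1 -> `|y - x| < d -> `|f y - f x| < e.
Proof.
rewrite /cont01; split=> [/subspace_continuousP cf x x01 e e0|H].
  have xI : `[0, 1]%classic x by rewrite /= in_itv.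
  have := cf x xI => /cvgrPdist_lt /(_ e e0).
  rewrite near_withinE => -[d /= d0 H]; exists d => // y y01 yx.
  rewrite distrC; apply: H; first by rewrite /= distrC.
  by rewrite /= in_itv.
apply/subspace_continuousP => x; rewrite /= in_itv /= => x01.
apply/cvgrPdist_lt => e e0; have [d d0 Hd] := H x x01 e e0.
rewrite near_withinE; exists d => //= y yx; rewrite in_itv /= => y01.
by rewrite distrC; apply: Hd => //; rewrite distrC.
Qed.

Lemma cont01_cont f : continuous f -> cont01 f.
Proof. by move=> cf; exact: continuous_subspaceT. Qed.

Lemma cont01_pt f : (forall x, 0 <= x <= 1 -> {for x, continuous f}) -> cont01 f.
Proof.
move=> cf; apply/subspace_continuousP => x /=; rewrite in_itv /= => x01.
by apply: cvg_within_filter; exact: cf.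
Qed.

Lemma cont01_comp f (h : R -> R) : cont01 f ->
  (forall x, 0 <= x <= 1 -> {for f x, continuous h}) -> cont01 (h \o f).
Proof.
move=> /subspace_continuousP cf ch; apply/subspace_continuousP => x xI /=.
apply: (cvg_comp f h (cf x xI)); apply: ch.
by move: xI; rewrite /= in_itv.
Qed.

Lemma cont01D f g : cont01 f -> cont01 g -> cont01 (fun x => f x + g x).
Proof. by move=> cf cg x; apply: continuousD; [exact: cf|exact: cg]. Qed.

Lemma cont01N f : cont01 f -> cont01 (fun x => - f x).
Proof. by move=> cf x; apply: continuousN; exact: cf. Qed.

Lemma cont01B f g : cont01 f -> cont01 g -> cont01 (fun x => f x - g x).
Proof. by move=> cf cg; apply: cont01D => //; exact: cont01N. Qed.

Lemma cont01M f g : cont01 f -> cont01 g -> cont01 (fun x => f x * g x).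
Proof. by move=> cf cg x; apply: continuousM; [exact: cf|exact: cg]. Qed.

Lemma cont01_cst c : cont01 (fun _ : R => c).
Proof. by apply: cont01_cont; exact: cst_continuous. Qed.

Lemma cont01X f n : cont01 f -> cont01 (fun x => f x ^+ n).
Proof.
move=> cf; elim: n => [|n IH]; first exact: cont01_cst.
have -> : (fun x => f x ^+ n.+1) = (fun x => f x * f x ^+ n).
  by apply/funext => x; rewrite exprS.
exact: cont01M.
Qed.

Lemma cont01_bounded f : cont01 f ->
  exists2 m, 0 < m & forall x, 0 <= x <= 1 -> `|f x| <= m.
Proof.
move=> cf; have cn : cont01 (fun x => `|f x|).
  by apply: (cont01_comp cf) => x _; exact: norm_continuous.
have [c _ Hc] := EVT_max ler01 cn.
exists (`|f c| + 1); first by rewrite ltr_wpDl.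
by move=> x x01; apply: ler_wpDr => //; apply: Hc; rewrite in_itv.
Qed.

(** Heine's theorem. In the covering form of compactness, the modulus d plays
    the role of the filter parameter. *)
Lemma cont01_uniform f : cont01 f -> forall e, 0 < e -> exists2 d, 0 < d &
  forall x y, 0 <= x <= 1 -> 0 <= y <= 1 -> `|y - x| < d -> `|f y - f x| < e.
Proof.
move=> /cont01P cf e e0.
have /compact_near_coveringP := @segment_compact R 0 1.
move=> /(_ R (0^'+) (fun d x => 0 <= x <= 1 ->
   forall y, 0 <= y <= 1 -> `|y - x| < d -> `|f y - f x| < e) _).
case.
  move=> x; rewrite /= in_itv /= => x01.
  have [d d0 Hd] := cf x x01 (e / 2) (divr_gt0 e0 (ltr0n _ 2)).
  have d2 : 0 < d / 2 by rewrite divr_gt0.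
  exists (ball x (d / 2), [set r | 0 < r < d / 2]).
    split; first exact: nbhsx_ballx.
    exists (d / 2) => //= r /=; rewrite sub0r normrN => + r0.
    by rewrite gtr0_norm // r0.
  case=> x' r /= [xx' /andP[r0 rd]] x'01 y y01 yx'.
  have h1 : `|f x' - f x| < e / 2.
    by apply: Hd => //; rewrite distrC; apply: lt_trans xx' _; lra.
  have h2 : `|f y - f x| < e / 2.
    apply: Hd => //; rewrite -(subrK x' y) -addrA.
    apply: le_lt_trans (ler_normD _ _) _.
    have : `|x' - x| < d / 2 by rewrite distrC.
    by lra.
  rewrite -(subrK (f x) (f y)) -addrA; apply: le_lt_trans (ler_normD _ _) _.
  by rewrite (distrC (f x)); lra.
move=> r /= r0 Hr; exists (r / 2); first by rewrite divr_gt0.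
have r2 : 0 < r / 2 by rewrite divr_gt0.
move=> x y x01.
have xI : `[0, 1]%classic x by rewrite /= in_itv.
apply: (Hr (r / 2) _ r2 x xI x01 y).
by rewrite /= sub0r normrN gtr0_norm //; lra.
Qed.

End Interval.

(** * Integrals over subintervals of the unit interval *)

Section Integrals.
Context {R : realType}.
Notation mu := (@lebesgue_measure R).
Implicit Types (f g : R -> R) (x y : R).

Lemma intg01_cont f : cont01 f -> intg01 f.
Proof.
by move=> cf; apply: continuous_compact_integrable => //; exact: segment_compact.
Qed.

Lemma intg01D f g : intg01 f -> intg01 g -> intg01 (fun x => f x + g x).
Proof. by move=> fi gi; exact: (integrableD _ fi gi). Qed.

Lemma intg01N f : intg01 f -> intg01 (fun x => - f x).
Proof. by move=> fi; exact: (integrableN fi). Qed.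

Lemma intg01B f g : intg01 f -> intg01 g -> intg01 (fun x => f x - g x).
Proof. by move=> fi gi; apply: intg01D => //; exact: intg01N. Qed.

Lemma intg01_norm f : intg01 f -> intg01 (fun x => `|f x|).
Proof. by move=> fi; exact: (integrable_norm fi). Qed.

Lemma cont01_measurable f : cont01 f -> measurable_fun (`[0, 1] : set R) f.
Proof.
by move=> /intg01_cont/integrableP[/measurable_EFinP].
Qed.

Lemma intg01_le f g : measurable_fun (`[0, 1] : set R) f -> intg01 g ->
  (forall x, 0 <= x <= 1 -> `|f x| <= g x) -> intg01 f.
Proof.
move=> mf gi fg; apply: (le_integrable _ _ _ gi) => //.
- exact/measurable_EFinP.
- move=> x /=; rewrite in_itv /= => x01; rewrite lee_fin.
  exact: le_trans (fg x x01) (ler_norm _).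
Qed.

Lemma intg01_measurable f : intg01 f -> measurable_fun (`[0, 1] : set R) f.
Proof. by move=> /integrableP[/measurable_EFinP]. Qed.

Lemma intg01Z c f : intg01 f -> intg01 (fun x => c * f x).
Proof. by move=> fi; exact: (integrableZl _ c fi). Qed.

Lemma intg01M f g : cont01 f -> intg01 g -> intg01 (fun x => f x * g x).
Proof.
move=> cf gi; have [m m0 fm] := cont01_bounded cf.
apply: (@intg01_le _ (fun x => m * `|g x|)).
- by apply: measurable_funM; [exact: cont01_measurable|exact: intg01_measurable].
- by apply: intg01Z; exact: intg01_norm.
- by move=> x x01; rewrite normrM ler_wpM2r // fm.
Qed.

Lemma intg01_cst c : intg01 (fun _ : R => c).
Proof. by apply: intg01_cont; exact: cont01_cst. Qed.

Lemma intg01_sub f x y : intg01 f -> 0 <= x -> y <= 1 ->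
  mu.-integrable `[x, y] (EFin \o f).
Proof.
move=> fi x0 y1; apply: (integrableS _ _ _ fi) => // z /=.
by rewrite !in_itv /= => /andP[xz zy]; rewrite (le_trans x0 xz) (le_trans zy y1).
Qed.

Lemma int_diff f x y : intg01 f -> 0 <= x -> x <= y -> y <= 1 ->
  \int[mu]_(t in `[0, y]) f t - \int[mu]_(t in `[0, x]) f t
  = \int[mu]_(t in `[x, y]) f t.
Proof.
move=> fi x0 xy y1.
rewrite (@Rintegral_itvB _ f (BLeft 0) (BRight y) x).
- rewrite Rintegral_itv_obnd_cbnd //.
  by apply: integrableS (intg01_sub fi x0 y1) => //; exact: subset_itv_oc_cc.
- exact: (intg01_sub fi (lexx 0) y1).
- by rewrite bnd_simp.
- by rewrite bnd_simp.
Qed.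

Lemma int_set1 f x : \int[mu]_(t in `[x, x]) f t = 0.
Proof. by rewrite set_itv1 Rintegral_set1. Qed.

Lemma int01_oo f : intg01 f ->
  \int[mu]_(t in `]0, 1[) f t = \int[mu]_(t in `[0, 1]) f t.
Proof.
move=> fi; rewrite Rintegral_itv_bndo_bndc.
  rewrite Rintegral_itv_obnd_cbnd //.
  by apply: integrableS fi => //; exact: subset_itv_oc_cc.
by apply: integrableS fi => //; exact: subset_itv_oo_cc.
Qed.

(** The two endpoints form a null set, so integrability may be tested on the
    open interval, which is where weak derivatives live. *)
Lemma intg01_ooP f : intg01 f <-> mu.-integrable `]0, 1[ (EFin \o f).
Proof.
split=> [fi|fi].
  by apply: integrableS fi => //; exact: subset_itv_oo_cc.
have mf : measurable_fun (`[0, 1] : set R) f.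
  move/integrableP : (fi) => [/measurable_EFinP mf _].
  exact: (measurable_fun_itv_cc mf).
have N0 : mu ([set 0; 1] : set R) = 0%E.
  by apply: countable_lebesgue_measure0; apply/finite_set_countable; exact: finite_set2.
apply/(@negligible_integrable _ _ _ mu _ [set 0; 1]) => //.
- by apply: measurableU; exact: measurable_set1.
- exact/measurable_EFinP.
- apply: integrableS fi => //.
    by apply: measurableD => //; apply: measurableU; exact: measurable_set1.
  move=> x /= []; rewrite !in_itv /= => /andP[x0 x1] /not_orP[n0 n1].
  rewrite !lt_neqAle x0 x1 !andbT; apply/andP; split; apply/eqP => E; [exact: n0|exact: n1].
Qed.

End Integrals.

(** * Absolutely continuous functions *)

(** Indefinite integrals: g is a chosen almost everywhere derivative of the
    absolutely continuous function f. *)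
Definition ac01 (R : realType) (f g : R -> R) := intg01 g /\
  forall x, 0 <= x <= 1 ->
    f x = f 0 + \int[@lebesgue_measure R]_(t in `[0, x]) g t.

Section AbsolutelyContinuous.
Context {R : realType}.
Notation mu := (@lebesgue_measure R).
Implicit Types (f g : R -> R) (x y : R).

Lemma ac01_diff f g x y : ac01 f g -> 0 <= x -> x <= y -> y <= 1 ->
  f y - f x = \int[mu]_(t in `[x, y]) g t.
Proof.
move=> [gi fE] x0 xy y1; rewrite -(int_diff gi x0 xy y1).
rewrite (fE y) ?(le_trans x0 xy) // (fE x) ?x0 ?(le_trans xy y1) //.
by rewrite opprD addrACA subrr add0r.
Qed.

Lemma ac01_int f g : ac01 f g -> \int[mu]_(t in `[0, 1]) g t = f 1 - f 0.
Proof. by move=> fg; rewrite (ac01_diff fg). Qed.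

Lemma eq_cont01 f g : (forall x, 0 <= x <= 1 -> f x = g x) ->
  cont01 f -> cont01 g.
Proof.
move=> fg /cont01P cf; apply/cont01P => x x01 e e0.
have [d d0 Hd] := cf x x01 e e0; exists d => // y y01 yx.
by rewrite -!fg //; exact: Hd.
Qed.

Lemma ac01_cont f g : ac01 f g -> cont01 f.
Proof.
move=> [gi fE].
apply: (@eq_cont01 (fun x => f 0 + \int[mu]_(t in `[0, x]) g t)).
  by move=> x x01; rewrite [RHS]fE.
apply: cont01D; first exact: cont01_cst.
exact: (parameterized_integral_continuous ler01 gi).
Qed.

Lemma ac01D f f' g g' : ac01 f f' -> ac01 g g' ->
  ac01 (fun x => f x + g x) (fun x => f' x + g' x).
Proof.
move=> [fi fE] [gi gE]; split; first exact: intg01D.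
move=> x x01; rewrite RintegralD //.
- by rewrite [f x]fE // [g x]gE // addrACA.
- by apply: intg01_sub => //; case/andP: x01.
- by apply: intg01_sub => //; case/andP: x01.
Qed.

Lemma ac01Z c f f' : ac01 f f' -> ac01 (fun x => c * f x) (fun x => c * f' x).
Proof.
move=> [fi fE]; split; first exact: intg01Z.
move=> x x01; rewrite RintegralZl //; first by rewrite -mulrDr -fE.
by apply: intg01_sub => //; case/andP: x01.
Qed.

Lemma ac01_eq f f' g g' : (forall x, 0 <= x <= 1 -> f x = g x) ->
  (forall x, 0 <= x <= 1 -> f' x = g' x) -> ac01 f f' -> ac01 g g'.
Proof.
move=> fg fg' [fi fE]; split.
  apply: eq_integrable fi => // x.
  by rewrite inE /= in_itv /= => x01; rewrite fg'.
move=> x x01; rewrite -!fg ?lexx ?ler01 // fE //; congr (_ + _).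
apply: eq_Rintegral => t; rewrite inE /= in_itv /= => /andP[t0 tx].
by rewrite fg' // t0 (le_trans tx) //; case/andP: x01.
Qed.

Lemma ac01B f f' g g' : ac01 f f' -> ac01 g g' ->
  ac01 (fun x => f x - g x) (fun x => f' x - g' x).
Proof.
move=> ff /(ac01Z (-1)) gg; apply: ac01_eq (ac01D ff gg) => x _; lra.
Qed.

(** Cut the interval into pieces shorter than d and add up the increments. *)
Lemma local_increments f (N : R -> R) d : 0 < d ->
  (forall x y, 0 <= x -> x <= y -> y <= 1 -> y - x < d ->
     `|f y - f x| <= N y - N x) ->
  forall x, 0 <= x <= 1 -> `|f x - f 0| <= N x - N 0.
Proof.
move=> d0 H x /andP[x0 x1].
have [n nd] : exists n : nat, d^-1 < n.+1%:R.
  exists (Num.truncn d^-1); exact: truncnS_gt.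
have n0 : 0 < n.+1%:R :> R by rewrite ltr0n.
have dn : n.+1%:R^-1 < d by rewrite invf_plt ?posrE.
have step (k : nat) : (k <= n.+1)%N ->
    `|f (x * (k%:R / n.+1%:R)) - f 0| <= N (x * (k%:R / n.+1%:R)) - N 0.
  elim: k => [_|k IH kn]; first by rewrite mul0r mulr0 !subrr normr0.
  have kn' : (k <= n.+1)%N by apply: ltnW.
  have h1 : 0 <= k%:R / n.+1%:R :> R by rewrite divr_ge0.
  have h2 : k.+1%:R / n.+1%:R <= 1 :> R by rewrite ler_pdivrMr // mul1r ler_nat.
  have h3 : k.+1%:R / n.+1%:R = k%:R / n.+1%:R + n.+1%:R^-1 :> R.
    by rewrite -natr1 mulrDl mul1r.
  have h4 : 0 < n.+1%:R^-1 :> R by rewrite invr_gt0.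
  move: (IH kn') h1 h2 h3 h4 dn.
  set b : R := k.+1%:R / n.+1%:R; set a : R := k%:R / n.+1%:R.
  set i : R := n.+1%:R^-1 => {}IH h1 h2 h3 h4 dn.
  have K : `|f (x * b) - f (x * a)| <= N (x * b) - N (x * a).
    apply: H; nra.
  have -> : f (x * b) - f 0 = (f (x * b) - f (x * a)) + (f (x * a) - f 0).
    by rewrite addrA subrK.
  apply: le_trans (ler_normD _ _) _.
  by lra.
have := step n.+1 (leqnn _).
by rewrite divff ?mulr1 // gt_eqF.
Qed.

(** Chain rule. The increment of h along f over a short interval is
    k (f t) times the integral of g there, for a single intermediate t, while
    the integral of k (f s) * g s uses k at the running point; by uniform
    continuity of k \o f the two differ by at most a small multiple of the
    integral of |g|, so their difference has total increment zero. The mean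
    value hypothesis is left abstract so that h need only be differentiable on
    the range of f. *)
Lemma ac01_chain f g (h k : R -> R) : ac01 f g ->
  (forall x, 0 <= x <= 1 -> {for f x, continuous k}) ->
  (forall x y, 0 <= x -> x <= y -> y <= 1 ->
     exists2 t, x <= t <= y & h (f y) - h (f x) = k (f t) * (f y - f x)) ->
  ac01 (fun x => h (f x)) (fun x => k (f x) * g x).
Proof.
move=> fg kc mvt; have fc := ac01_cont fg.
have kfc : cont01 (k \o f) by apply: cont01_comp.
have gi := fg.1.
have ii : intg01 (fun x => k (f x) * g x) by exact: intg01M.
split => // x x01.
pose D y := h (f y) - \int[mu]_(t in `[0, y]) (k (f t) * g t).
suff : D x = D 0 by rewrite /D int_set1 subr0 => /eqP; rewrite subr_eq => /eqP.
apply/eqP; rewrite -subr_eq0 -normr_le0; apply/ler_addgt0Pl => e e0; rewrite addr0.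
(* N measures the allowed increments; 1 + N 1 keeps the divisor positive *)
pose N y := \int[mu]_(t in `[0, y]) `|g t|.
have gni := intg01_norm gi.
have N1 : 0 <= N 1 by apply: Rintegral_ge0.
have e'0 : 0 < e / (1 + N 1) by rewrite divr_gt0 // ltr_wpDr.
have [d d0 Hd] := cont01_uniform kfc e'0.
have := @local_increments D (fun y => e / (1 + N 1) * N y) d d0 _ x x01.
move=> H; apply: (le_trans (H _)) => {H}.
  move=> y z y0 yz z1 zyd.
  have [t /andP[yt tz] E] := mvt y z y0 yz z1.
  have -> : D z - D y = \int[mu]_(s in `[y, z]) ((k (f t) - k (f s)) * g s).
    rewrite /D opprD addrACA E -opprD (int_diff ii) // (ac01_diff fg) //.
    rewrite -RintegralZl //; last exact: intg01_sub.
    rewrite -RintegralB //; [|exact: (intg01_sub (intg01Z _ gi))|exact: intg01_sub].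
    by apply: eq_Rintegral => s _; rewrite mulrBl.
  have li : intg01 (fun s => (k (f t) - k (f s)) * g s).
    by apply: intg01M => //; apply: cont01B => //; exact: cont01_cst.
  apply: le_trans (le_normr_Rintegral _ _) _ => //; first exact: intg01_sub.
  rewrite -mulrBr (int_diff gni) // -RintegralZl //; last exact: intg01_sub.
  apply: le_Rintegral => //.
  - exact: (intg01_sub (intg01_norm li)).
  - exact: (intg01_sub (intg01Z _ gni)).
  move=> s /=; rewrite in_itv /= => /andP[ys sz].
  rewrite normrM ler_wpM2r //; apply/ltW/Hd.
  - by rewrite (le_trans y0 ys) (le_trans sz z1).
  - by rewrite (le_trans y0 yt) (le_trans tz z1).
  - by rewrite ltr_norml; lra.
have Nx : N x - N 0 <= N 1.
  rewrite /N int_set1 subr0 -subr_ge0 (int_diff gni) //; case/andP: x01 => // _ _.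
  exact: Rintegral_ge0.
rewrite -mulrBr; apply: le_trans (_ : e / (1 + N 1) * N 1 <= _).
  by rewrite ler_wpM2l // ltW.
by rewrite mulrAC ler_pdivrMr ?ltr_wpDr // ler_wpM2l ?(ltW e0) // lerDr.
Qed.

(** For the square, the mean value is the midpoint of the two values. *)
Lemma ac01_sqr f g : ac01 f g -> ac01 (fun x => f x ^+ 2) (fun x => 2 * f x * g x).
Proof.
move=> fg; apply: (@ac01_chain f g (fun t => t ^+ 2) (fun t => 2 * t)) => //.
  by move=> x _; apply: continuousM => //; exact: cst_continuous.
move=> x y x0 xy y1.
have fc : {within `[x, y], continuous f}.
  apply: continuous_subspaceW (ac01_cont fg) => z /=; rewrite !in_itv /=.
  by move=> /andP[xz zy]; rewrite (le_trans x0 xz) (le_trans zy y1).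
have [|t txy tE] := @IVT _ f x y ((f x + f y) / 2) xy fc.
  by rewrite /Num.min /Num.max; case: (ltP (f x) (f y)) => ?; lra.
exists t; first by rewrite in_itv in txy.
by rewrite tE; lra.
Qed.

(** Leibniz rule, by polarization of the rule for squares. *)
Lemma ac01M f f' g g' : ac01 f f' -> ac01 g g' ->
  ac01 (fun x => f x * g x) (fun x => f' x * g x + f x * g' x).
Proof.
move=> ff gg.
have s1 := ac01_sqr (ac01D ff gg).
have s2 := ac01_sqr (ac01B ff gg).
by apply: ac01_eq (ac01Z (4^-1) (ac01B s1 s2)) => x _ /=; lra.
Qed.

(** The point given by the mean value theorem lies between two values of f, so
    by the intermediate value theorem it is itself a value of f. *)
Lemma ac01_comp f g (a : R) (h k : R -> R) : ac01 f g ->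
  (forall x, 0 <= x <= 1 -> a < f x) ->
  (forall t, a < t -> is_derive t 1 h (k t)) ->
  (forall t, a < t -> {for t, continuous k}) ->
  ac01 (fun x => h (f x)) (fun x => k (f x) * g x).
Proof.
move=> fg fa hk kc; apply: ac01_chain => //; first by move=> x /fa; exact: kc.
move=> x y x0 xy y1.
have fx : a < f x by apply: fa; rewrite x0 (le_trans xy).
have fy : a < f y by apply: fa; rewrite (le_trans x0).
have fc : {within `[x, y], continuous f}.
  apply: continuous_subspaceW (ac01_cont fg) => z /=; rewrite !in_itv /=.
  by move=> /andP[xz zy]; rewrite (le_trans x0 xz) (le_trans zy y1).
have mvt u v : a < u -> u <= v -> exists2 c, u <= c <= v & h v - h u = k c * (v - u).
  move=> au uv; have [| |c c1 c2] := @MVT_segment _ h k u v uv.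
  - move=> z; rewrite in_itv /= => /andP[uz _]; apply: hk; exact: lt_trans uz.
  - apply: derivable_within_continuous => z; rewrite in_itv /= => /andP[uz _].
    by have [] := hk z (lt_le_trans au uz).
  - by exists c => //; rewrite in_itv in c1.
have [c cE hE] : exists2 c, Num.min (f x) (f y) <= c <= Num.max (f x) (f y) &
    h (f y) - h (f x) = k c * (f y - f x).
  rewrite /Num.min /Num.max; case: (ltP (f x) (f y)) => fxy.
    by have [c c1 c2] := mvt _ _ fx (ltW fxy); exists c.
  by have [c c1 c2] := mvt _ _ fy fxy; exists c => //; lra.
have [t txy tE] := @IVT _ f x y c xy fc cE.
by exists t; [rewrite in_itv in txy|rewrite tE].
Qed.

End AbsolutelyContinuous.

(** * Square integrable functions and weak derivatives *)

Section SquareIntegrable.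
Context {R : realType}.
Implicit Types (f g : R -> R) (x y : R).

Lemma L2_01P f : L2_01 f <->
  measurable_fun (`[0, 1] : set R) f /\ intg01 (fun x => f x ^+ 2).
Proof.
split=> [[mf fi]|[mf fi]]; split.
- exact: (measurable_fun_itv_cc mf).
- exact/intg01_ooP.
- by apply: measurable_funS mf => //; exact: subset_itv_oo_cc.
- exact/intg01_ooP.
Qed.

Lemma L2_intgM f g : L2_01 f -> L2_01 g -> intg01 (fun x => f x * g x).
Proof.
move=> /L2_01P[mf fi] /L2_01P[mg gi].
apply: (@intg01_le _ _ (fun x => f x ^+ 2 + g x ^+ 2)).
- exact: measurable_funM.
- exact: intg01D.
- by move=> x _; rewrite ler_norml; apply/andP; split; nra.
Qed.

Lemma L2_cont f : cont01 f -> L2_01 f.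
Proof.
move=> cf; apply/L2_01P; split; first exact: cont01_measurable.
by apply: intg01_cont; exact: cont01X.
Qed.

Lemma L2_intg f : L2_01 f -> intg01 f.
Proof.
move=> fi; have := L2_intgM fi (L2_cont (@cont01_cst R 1)).
by under eq_fun do rewrite mulr1.
Qed.

Lemma L2_D f g : L2_01 f -> L2_01 g -> L2_01 (fun x => f x + g x).
Proof.
move=> lf lg; have [mf fi] := (L2_01P f).1 lf; have [mg gi] := (L2_01P g).1 lg.
apply/L2_01P; split; first exact: measurable_funD.
have -> : (fun x => (f x + g x) ^+ 2) =
    (fun x => (f x ^+ 2 + g x ^+ 2) + 2 * (f x * g x)).
  by apply/funext => x; ring.
apply: intg01D; first exact: intg01D.
by apply: intg01Z; exact: L2_intgM.
Qed.

Lemma L2_M f g : cont01 f -> L2_01 g -> L2_01 (fun x => f x * g x).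
Proof.
move=> cf /L2_01P[mg gi]; apply/L2_01P; split.
  by apply: measurable_funM => //; exact: cont01_measurable.
under eq_fun do rewrite exprMn.
by apply: intg01M => //; exact: cont01X.
Qed.

Lemma L2_Z c g : L2_01 g -> L2_01 (fun x => c * g x).
Proof. by apply: L2_M; exact: cont01_cst. Qed.

Lemma L2_B f g : L2_01 f -> L2_01 g -> L2_01 (fun x => f x - g x).
Proof.
move=> lf lg; have := L2_D lf (L2_Z (-1) lg).
by under eq_fun do rewrite mulN1r.
Qed.

End SquareIntegrable.

(* These forms leave lambda expressions as they are, so that the derivative of a
   composite formula is computed by nesting them. *)
Section DeriveRules.
Context {R : realType}.
Implicit Types (f g : R -> R) (x : R).

Lemma is_derive_funD f g x a b : is_derive x (1 : R) f a -> is_derive x (1 : R) g b ->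
  is_derive x (1 : R) (fun t => f t + g t) (a + b).
Proof. by move=> fa gb; exact: is_deriveD. Qed.

Lemma is_derive_funN f x a : is_derive x (1 : R) f a ->
  is_derive x (1 : R) (fun t => - f t) (- a).
Proof. by move=> fa; exact: is_deriveN. Qed.

Lemma is_derive_funB f g x a b : is_derive x (1 : R) f a -> is_derive x (1 : R) g b ->
  is_derive x (1 : R) (fun t => f t - g t) (a - b).
Proof. by move=> fa gb; exact: is_deriveB. Qed.

Lemma is_derive_funM f g x a b : is_derive x (1 : R) f a -> is_derive x (1 : R) g b ->
  is_derive x (1 : R) (fun t => f t * g t) (a * g x + f x * b).
Proof.
move=> fa gb; apply: (is_derive_eq (is_deriveM fa gb)).
by rewrite /GRing.scale /=; ring.
Qed.

Lemma is_derive_funZ c f x a : is_derive x (1 : R) f a ->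
  is_derive x (1 : R) (fun t => c * f t) (c * a).
Proof. by move=> fa; exact: is_deriveZ. Qed.

Lemma is_derive_fun_comp f g x a b : is_derive (g x) (1 : R) f a ->
  is_derive x (1 : R) g b -> is_derive x (1 : R) (fun t => f (g t)) (a * b).
Proof. by move=> fa gb; exact: is_derive1_comp. Qed.

End DeriveRules.

Section WeakDerivative.
Context {R : realType}.
Notation mu := (@lebesgue_measure R).
Implicit Types (f g : R -> R) (x y : R).

Lemma is_derive_cont f x d : is_derive x (1 : R) f d -> {for x, continuous f}.
Proof.
by case=> df _; apply/differentiable_continuous/derivable1_diffP.
Qed.

Lemma ac01_C1 f g : (forall x, 0 <= x <= 1 -> is_derive x 1 f (g x)) ->
  cont01 g -> ac01 f g.
Proof.
move=> fg cg; split; first exact: intg01_cont.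
move=> x /andP[]; rewrite le_eqVlt => /orP[/eqP <- _|x0 x1].
  by rewrite int_set1 addr0.
have xx z : z \in `[0, x] -> 0 <= z <= 1.
  by rewrite in_itv /= => /andP[-> zx]; exact: le_trans zx x1.
have -> : \int[mu]_(t in `[0, x]) g t = f x - f 0.
  rewrite /Rintegral (@continuous_FTC2 _ g f) //.
  - by apply: continuous_subspaceW cg => z /xx; rewrite /= in_itv.
  - have fc z : 0 <= z <= 1 -> {for z, continuous f}.
      by move=> z01; have /is_derive_cont := fg z z01.
    split.
    + move=> z /subset_itv_oo_cc zx; by have [] := fg z (xx z zx).
    + by apply: cvg_at_right_filter; apply: fc; rewrite lexx ler01.
    + by apply: cvg_at_left_filter; apply: fc; rewrite (ltW x0).
  - move=> z /subset_itv_oo_cc zx; rewrite derive1E.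
    by have [_ ->] := fg z (xx z zx).
by rewrite addrC subrK.
Qed.

(** Integration by parts: the product with a test function is absolutely
    continuous and vanishes at both ends. *)
Lemma ac01_weak_derivative f g : ac01 f g -> L2_01 g -> is_weak_derivative f g.
Proof.
move=> fg lg; split => // phi [dphi cphi [a [b [a0 b1 phi0]]]].
have p0 : phi 0 = 0 by apply: phi0; rewrite in_itv /= negb_and -!ltNge a0.
have p1 : phi 1 = 0 by apply: phi0; rewrite in_itv /= negb_and -!ltNge b1 orbT.
have cp := cont01_cont cphi.
have ap : ac01 phi (derive1 phi).
  apply: ac01_C1 => // x _; rewrite derive1E.
  by split => //; exact: dphi.
have fpg := ac01M fg ap.
have i1 : intg01 (fun x => f x * derive1 phi x).
  by apply: intg01_cont; apply: cont01M => //; exact: ac01_cont fg.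
have i2 : intg01 (fun x => g x * phi x).
  under eq_fun do rewrite mulrC.
  by apply: intg01M (L2_intg lg); exact: ac01_cont ap.
have := ac01_int fpg; rewrite p0 p1 !mulr0 subrr RintegralD //.
rewrite !int01_oo //; lra.
Qed.

Definition pos (t : R) := Num.max 0 t.

Lemma pos_cont : continuous pos.
Proof.
move=> x; apply: continuous_max; first exact: cst_continuous.
exact: cvg_id.
Qed.

(** A quadratic Taylor bound avoids differentiating the spline pos (t - a) ^+ 2
    by cases at its knot. *)
Lemma is_derive_quadratic_remainder f x d K :
  (forall z, `|f z - f x - d * (z - x)| <= K * (z - x) ^+ 2) ->
  is_derive x (1 : R) f d.
Proof.
move=> H; apply/is_derive1_caratheodory.
exists (fun z => if z == x then d else (f z - f x) / (z - x)); split.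
- move=> z; case: eqP => [->|/eqP zx]; first by rewrite !subrr mulr0.
  by rewrite divfK // subr_eq0.
- apply/cvgrPdist_lt => e e0; rewrite eqxx.
  have K0 : 0 <= K.
    by have := le_trans (normr_ge0 _) (H (x + 1)); rewrite addrAC subrr add0r expr1n mulr1.
  exists (e / (1 + K)) => /=; first by rewrite divr_gt0 // ltr_wpDr.
  move=> z /=; rewrite ltr_pdivlMr ?ltr_wpDr // => zx.
  case: eqP => [_|/eqP nzx]; first by rewrite subrr normr0.
  have nz : z - x != 0 by rewrite subr_eq0.
  have -> : d - (f z - f x) / (z - x) = - ((f z - f x - d * (z - x)) / (z - x)).
    by field.
  rewrite normrN normrM normfV; apply: le_lt_trans zx.
  rewrite ler_pdivrMr ?normr_gt0 //; apply: le_trans (H z) _.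
  rewrite (distrC x) -real_normK ?num_real // [in leLHS]expr2 -!mulrA.
  have := normr_ge0 (z - x); nra.
- by rewrite eqxx.
Qed.

Lemma is_derive_pos_sqr a x :
  is_derive x (1 : R) (fun t => pos (t - a) ^+ 2) (2 * pos (x - a)).
Proof.
apply: (@is_derive_quadratic_remainder _ _ _ 1) => z; rewrite mul1r ler_norml.
have -> : z - x = (z - a) - (x - a) by ring.
move: (z - a) (x - a) => u v; rewrite /pos /Num.max.
have := sqr_ge0 (u - v).
by case: (ltP 0 u) => u0; case: (ltP 0 v) => v0 ?; apply/andP; split; nra.
Qed.

(** An approximate identity: the tent function of unit mass supported in
    [a, a + 2h], as a combination of kinks. *)
Definition tent h a x :=
  (h ^+ 2)^-1 * (pos (x - a) - 2 * pos (x - (a + h)) + pos (x - (a + 2 * h))).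
(** The C^1 primitive of the tent, going from 0 to 1. The difference of two such
    steps is a test function whose derivative is the difference of two tents. *)
Definition step h a x :=
  (2 * h ^+ 2)^-1 *
  (pos (x - a) ^+ 2 - 2 * pos (x - (a + h)) ^+ 2 + pos (x - (a + 2 * h)) ^+ 2).

Lemma is_derive_step h a x : 0 < h -> is_derive x (1 : R) (step h a) (tent h a x).
Proof.
move=> h0; have D b := is_derive_pos_sqr b x.
have := is_derive_funZ (2 * h ^+ 2)^-1
  (is_derive_funD (is_derive_funB (D a) (is_derive_funZ 2 (D (a + h)))) (D (a + 2 * h))).
move=> /is_derive_eq; apply; rewrite /tent; field.
by rewrite gt_eqF.
Qed.

Lemma tent_cont h a : continuous (tent h a).
Proof.
move=> x; have P b : pos (t - b) @[t --> x] --> pos (x - b).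
  apply: (@cvg_comp _ _ _ (fun t => t - b)); last exact: pos_cont.
  by apply: cvgB; [exact: cvg_id|exact: cvg_cst].
apply: cvgM; first exact: cvg_cst.
apply: cvgD => //; apply: cvgB => //.
by apply: cvgM => //; exact: cvg_cst.
Qed.

Lemma tent_ge0 h a x : 0 < h -> 0 <= tent h a x.
Proof.
move=> h0; apply: mulr_ge0; first by rewrite invr_ge0 exprn_ge0 // ltW.
rewrite /pos /Num.max.
case: (ltP 0 (x - a)) => ?; case: (ltP 0 (x - (a + h))) => ?;
 case: (ltP 0 (x - (a + 2 * h))) => ?; lra.
Qed.

Lemma tent_supp h a x : 0 < h -> x <= a \/ a + 2 * h <= x -> tent h a x = 0.
Proof.
move=> h0 H; suff E : pos (x - a) - 2 * pos (x - (a + h)) + pos (x - (a + 2 * h)) = 0.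
  by rewrite /tent E mulr0.
rewrite /pos /Num.max.
case: (ltP 0 (x - a)) => ?; case: (ltP 0 (x - (a + h))) => ?;
 case: (ltP 0 (x - (a + 2 * h))) => ?; lra.
Qed.

Lemma step_l h a x : 0 < h -> x <= a -> step h a x = 0.
Proof.
move=> h0 xa; rewrite /step /pos /Num.max !ifF; try (apply/negbTE; lra).
ring.
Qed.

Lemma step_r h a x : 0 < h -> a + 2 * h <= x -> step h a x = 1.
Proof.
move=> h0; rewrite /step /pos; rewrite le_eqVlt => /orP[/eqP <-|xa].
  rewrite subrr maxxx !max_r; [|lra..].
  by field; rewrite gt_eqF.
by rewrite !max_r; [|lra..]; field; rewrite gt_eqF.
Qed.

Lemma tent_average f h a e : 0 < h -> 0 <= a -> a + 2 * h <= 1 -> cont01 f ->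
  forall c, (forall x, a <= x <= a + 2 * h -> `|f x - c| <= e) ->
  `|\int[mu]_(x in `[0, 1]) (f x * tent h a x) - c| <= e.
Proof.
move=> h0 a0 a1 cf c H.
have ct := cont01_cont (@tent_cont h a).
have t1 : \int[mu]_(x in `[0, 1]) tent h a x = 1.
  have st : ac01 (step h a) (tent h a).
    by apply: ac01_C1 => // x _; exact: is_derive_step.
  by rewrite (ac01_int st) (step_l h0 a0) (step_r h0 a1) subr0.
have it := intg01_cont ct.
have cft := cont01M cf ct.
have -> : \int[mu]_(x in `[0, 1]) (f x * tent h a x) - c =
    \int[mu]_(x in `[0, 1]) ((f x - c) * tent h a x).
  under [RHS]eq_Rintegral do rewrite mulrBl.
  rewrite RintegralB //; [|exact: intg01_cont|exact: intg01Z].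
  by rewrite RintegralZl // t1 mulr1.
have ci : cont01 (fun x => (f x - c) * tent h a x).
  by apply: cont01M => //; apply: cont01B => //; exact: cont01_cst.
apply: le_trans (le_normr_Rintegral _ (intg01_cont ci)) _ => //.
have -> : e = \int[mu]_(x in `[0, 1]) (e * tent h a x).
  by rewrite RintegralZl // t1 mulr1.
apply: le_Rintegral => //.
- exact: intg01_norm (intg01_cont ci).
- exact: intg01Z.
move=> x _; rewrite normrM (ger0_norm (tent_ge0 _ _ h0)).
have [xa|ax] := leP x a; first by rewrite tent_supp ?mulr0 //; left.
have [xb|bx] := leP (a + 2 * h) x; first by rewrite tent_supp ?mulr0 //; right.
by rewrite ler_wpM2r ?tent_ge0 // H // !ltW.
Qed.

(** The lemma of du Bois-Reymond. Testing against the difference of two steps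
    shows that the averages of f against two tents agree, and by continuity
    these averages approximate the values of f at any two points. *)
Lemma weak_derivative0_cst f : cont01 f -> is_weak_derivative f (fun=> 0) ->
  forall x y, 0 <= x <= 1 -> 0 <= y <= 1 -> f x = f y.
Proof.
move=> cf [_ wf] x y x01 y01.
apply/eqP; rewrite -subr_eq0 -normr_le0; apply/ler_addgt0Pl => e e0; rewrite addr0.
have e4 : 0 < e / 2 by rewrite divr_gt0.
have [d d0 Hd] := cont01_uniform cf e4.
pose h := Num.min (d / 12) (1 / 12).
have h0 : 0 < h by rewrite lt_min !divr_gt0.
have hd : h <= d / 12 by rewrite ge_min lexx.
have h1 : h <= 1 / 12 by rewrite ge_min lexx orbT.
(* the tent based at p z stays inside (0, 1) and within distance 6h of z,
   also when z is an endpoint *)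
pose p z := (1 - 4 * h) * z + h.
have pb z : 0 <= z <= 1 -> h <= p z /\ p z + 2 * h <= 1 - h.
  by move=> /andP[z0 z1]; rewrite /p; split; nra.
have near_p z : 0 <= z <= 1 ->
    `|\int[mu]_(t in `[0, 1]) (f t * tent h (p z) t) - f z| <= e / 2.
  move=> z01; have [b1 b2] := pb z z01.
  apply: tent_average => //; [lra|lra|] => t /andP[t1 t2].
  apply/ltW/Hd => //; first by lra.
  rewrite ltr_norml; move: t1 t2 z01; rewrite /p => t1 t2 /andP[z0 z1].
  by apply/andP; split; nra.
have [bx1 bx2] := pb x x01; have [by1 by2] := pb y y01.
pose phi z := step h (p x) z - step h (p y) z.
have dphi z : is_derive z (1 : R) phi (tent h (p x) z - tent h (p y) z).
  by apply: is_derive_funB; exact: is_derive_step.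
have dE : derive1 phi = (fun z => tent h (p x) z - tent h (p y) z).
  by apply/funext => z; rewrite derive1E; have [_ ->] := dphi z.
have tphi : test_function phi.
  split.
  - by move=> z; have [] := dphi z.
  - by rewrite dE => z; apply: continuousB; exact: tent_cont.
  exists h, (1 - h); split; [lra|lra|] => z.
  rewrite in_itv /= negb_and -!ltNge /phi => /orP[zh|zh].
    by rewrite !step_l ?subrr //; lra.
  by rewrite !step_r ?subrr //; lra.
have := wf phi tphi.
under [X in _ = - X -> _]eq_Rintegral do rewrite mul0r.
rewrite Rintegral_cst // mul0r oppr0 dE.
have cx := cont01_cont (@tent_cont h (p x)).
have cy := cont01_cont (@tent_cont h (p y)).
have ix := intg01_cont (cont01M cf cx).
have iy := intg01_cont (cont01M cf cy).
under eq_Rintegral do rewrite mulrBr.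
rewrite int01_oo; last exact: intg01B.
rewrite RintegralB //.
move=> E; have := near_p x x01; have := near_p y y01; move: E.
set A := Rintegral _ _ _; set B := Rintegral _ _ _.
rewrite !ler_norml => E /andP[? ?] /andP[? ?]; apply/andP; split; lra.
Qed.

Lemma weak_derivativeB f f' g g' : cont01 f -> cont01 g ->
  is_weak_derivative f f' -> is_weak_derivative g g' ->
  is_weak_derivative (fun x => f x - g x) (fun x => f' x - g' x).
Proof.
move=> cf cg [lf wf] [lg wg]; split; first exact: L2_B.
move=> phi tphi; have [dphi cphi _] := tphi.
have cp : cont01 phi.
  by apply: cont01_cont => x; apply/differentiable_continuous/derivable1_diffP/dphi.
have cdp := cont01_cont cphi.
have oo u : intg01 u -> mu.-integrable `]0, 1[ (EFin \o u) by move=> /intg01_ooP.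
have i u : L2_01 u -> intg01 (fun x => u x * phi x).
  by move=> lu; under eq_fun do rewrite mulrC; apply: intg01M => //; exact: L2_intg.
under eq_Rintegral do rewrite mulrBl.
under [X in _ = - X]eq_Rintegral do rewrite mulrBl.
rewrite !RintegralB //; try by apply: oo; (exact: i || (apply: intg01_cont; exact: cont01M)).
by rewrite wf // wg // opprB opprK addrC.
Qed.

(** Subtracting the indefinite integral of the weak derivative leaves a
    continuous function with zero weak derivative. *)
Lemma weak_derivative_ac01 f g : cont01 f -> is_weak_derivative f g -> ac01 f g.
Proof.
move=> cf wf; have gi := L2_intg wf.1.
pose G x := \int[mu]_(t in `[0, x]) g t.
have aG : ac01 G g by split => // x x01; rewrite {2}/G int_set1 add0r.
have cG := ac01_cont aG.
have := weak_derivativeB cf cG wf (ac01_weak_derivative aG wf.1).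
under [X in is_weak_derivative _ X]eq_fun do rewrite subrr.
move=> /(weak_derivative0_cst (cont01B cf cG)) H.
split => // x x01; have := H x 0 x01.
rewrite lexx ler01 {2}/G int_set1 subr0 => /(_ isT) <-.
by rewrite subrK.
Qed.

End WeakDerivative.

Section Uniqueness.
Context {R : realType}.
Notation mu := (@lebesgue_measure R).
Implicit Types (f g : R -> R) (x y : R).

(** Uniqueness of the weak derivative: the indefinite integral of the difference
    vanishes, and Lebesgue's differentiation theorem recovers the integrand. *)
Lemma ac01_unique f g g' : ac01 f g -> ac01 f g' ->
  ae_eq mu `]0, 1[%classic g g'.
Proof.
move=> fg fg'; pose k x := g x - g' x.
have fk : ac01 (fun=> 0) k.
  by apply: ac01_eq (ac01B fg fg') => x _ //; rewrite subrr.
have ki := fk.1.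
pose kk := k \_ `[0, 1].
have kki : mu.-integrable setT (EFin \o kk).
  by rewrite -restrict_EFin; apply/integrable_restrict => //=; rewrite setTI.
have locf : locally_integrable [set: R] kk.
  by apply: integrable_locally.
have iy y : mu.-integrable `]-oo, y] (EFin \o kk) by apply: integrableS kki.
have F0 y : \int[mu]_(t in `]-oo, y]) kk t = 0.
  rewrite -Rintegral_mkcondr.
  have [y0|y0] := ltP y 0.
    rewrite (_ : _ `&` _ = set0) ?Rintegral_set0 //.
    apply/seteqP; split => // x /= []; rewrite !in_itv /= => xy /andP[x0 _].
    by have := lt_le_trans y0 x0; rewrite ltNge xy.
  have m1 : Num.min y 1 <= 1 by rewrite ge_min lexx orbT.
  have m0 : 0 <= Num.min y 1 by rewrite le_min y0 ler01.
  rewrite (_ : _ `&` _ = `[0, Num.min y 1]%classic).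
    by have := ac01_diff fk (lexx 0) m0 m1; rewrite subrr.
  apply/seteqP; split => x /=; rewrite !in_itv /= le_min.
    by move=> [-> /andP[-> ->]].
  by move=> /andP[-> /andP[-> ->]].
have := FTC1Ny iy locf.
apply: filterS; first exact: (ae_filter_ringOfSetsType mu).
move=> x [_]; rewrite (_ : (fun x => _) = cst 0); last first.
  by apply/funext => y; exact: F0.
rewrite derive1_cst /kk patchE => E x01; move: E.
rewrite mem_set; last exact: subset_itv_oo_cc.
by rewrite /k => /esym/eqP; rewrite subr_eq0 => /eqP.
Qed.

End Uniqueness.

(** * Convexity of the energy density in polar coordinates *)

Section Excess.
Context {R : realType}.

(** The density of the energy at the map rho * e^{i theta}, where sg stands for
    rho' and w for theta'. *)
Definition polar_density (L a eps rho sg w : R) :=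
  eps / 2 * (sg ^+ 2 + rho ^+ 2 * w ^+ 2) + 1 / (4 * eps) * (rho ^+ 2 - 1) ^+ 2
  + L / 2 * (rho ^+ 2 * w - a) ^+ 2.

(** The partial derivative of the density in w. It is constant along critical
    points, because theta itself does not occur in the density. *)
Definition angular_momentum (L a eps rho w : R) :=
  (eps * rho ^+ 2 + L * rho ^+ 4) * w - a * L * rho ^+ 2.

(** The partial derivative of the density in rho. *)
Definition radial_force (L a eps rho w : R) :=
  (eps * rho + 2 * L * rho ^+ 3) * w ^+ 2 - 2 * a * L * rho * w
  + (rho ^+ 2 - 1) * rho / eps.

(** The Weierstrass excess: what remains of the density after subtracting its
    first order expansion at (rho0, r1, w0). *)
Lemma polar_density_excess (L a eps rho rho0 sg r1 w w0 : R) :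
  0 < eps ->
  let p := rho - rho0 in let q := w - w0 in
  polar_density L a eps rho sg w - polar_density L a eps rho0 r1 w0
  - radial_force L a eps rho0 w0 * p - eps * r1 * (sg - r1) - angular_momentum L a eps rho0 w0 * q
  = eps / 2 * (sg - r1) ^+ 2
    + (eps * rho ^+ 2 + L * rho ^+ 4) / 2 * q ^+ 2
    + p * (rho + rho0) * ((eps + L * (rho ^+ 2 + rho0 ^+ 2)) * w0 - a * L) * q
    + ((eps + L * ((2 * rho0 + p) ^+ 2 + 2 * rho0 ^+ 2)) / 2 * w0 ^+ 2 - a * L * w0
       + (2 * (rho0 ^+ 2 - 1) + (rho + rho0) ^+ 2) / (4 * eps)) * p ^+ 2.
Proof.
move=> e0 p q; rewrite /p /q /polar_density /radial_force /angular_momentum; field.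
by rewrite gt_eqF.
Qed.

(** Complete the square after multiplying by L. *)
Lemma quadratic_form_ge0 (L B D p q : R) : 0 < L -> B ^+ 2 <= L * D * p ^+ 2 ->
  0 <= L / 4 * q ^+ 2 + B * q + D * p ^+ 2.
Proof.
move=> L0 H; rewrite -(pmulr_rge0 _ L0).
by have := sqr_ge0 (L / 2 * q + B); nra.
Qed.

(** A bound for the coefficient of (rho - rho0) * (w - w0) in the excess. *)
Definition excess_cst (L a W : R) := 4 * (W * (1 + 4 * L) + a * L).

(** The density lies above its tangent at (rho0, r1, w0). In the excess,
    the coefficient of (w - w0)^2 is at least L/4 and that of (rho - rho0)^2 at
    least 1/(4 eps), because of the potential term, while the mixed coefficient
    is bounded independently of eps; so the quadratic form is nonnegative once
    eps is small. The inequality holds for all real w, which matters because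
    the angular velocity of an H^1 competitor is unbounded. *)
Lemma polar_density_convex (L a W eps rho rho0 sg r1 w w0 : R) :
  0 < L -> 0 <= a -> 0 < eps -> eps <= 1 ->
  9 / 10 <= rho <= 12 / 10 -> 95 / 100 <= rho0 <= 105 / 100 -> `|w0| <= W ->
  4 * eps * (a * L * W) <= 1 -> 4 * eps * (excess_cst L a W) ^+ 2 <= L ->
  polar_density L a eps rho0 r1 w0
  + radial_force L a eps rho0 w0 * (rho - rho0) + eps * r1 * (sg - r1)
  + angular_momentum L a eps rho0 w0 * (w - w0) <= polar_density L a eps rho sg w.
Proof.
move=> L0 a0 e0 e1 /andP[r0 r0'] /andP[s0 s0'] wW c1 c2.
rewrite -subr_ge0.
have := polar_density_excess L a rho rho0 sg r1 w w0 e0 => /=.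
set p := rho - rho0; set q := w - w0.
have -> x y z t u : x - (y + z + t + u) = x - y - z - t - u :> R by ring.
move=> ->.
have W0 : 0 <= W by apply: le_trans wW.
move: wW; rewrite ler_norml => /andP[wl wu].
set B := p * (rho + rho0) * _; set A := (eps * _ + _) / 2; set D := (_ / 2 * _ - _ + _).
have Age : L / 4 <= A.
  rewrite /A; have : 1 / 2 <= rho ^+ 4.
    have h : 81 / 100 <= rho ^+ 2 by nra.
    rewrite (_ : rho ^+ 4 = (rho ^+ 2) ^+ 2); last by ring.
    by nra.
  have := sqr_ge0 rho; nra.
have Dge : 1 / (4 * eps) <= D.
  rewrite /D.
  have h1 : 0 <= (eps + L * ((2 * rho0 + p) ^+ 2 + 2 * rho0 ^+ 2)) / 2 * w0 ^+ 2.
    apply: mulr_ge0; last exact: sqr_ge0.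
    have := sqr_ge0 (2 * rho0 + p); have := sqr_ge0 rho0; nra.
  have aL : 0 <= a * L by nra.
  have h2 : - (1 / (4 * eps)) <= - (a * L * w0).
    rewrite lerN2 ler_pdivlMr ?mulr_gt0 //.
    by apply: le_trans c1; rewrite mulrC ler_pM2l ?mulr_gt0 // ler_wpM2l.
  have h3 : 2 / (4 * eps) <= (2 * (rho0 ^+ 2 - 1) + (rho + rho0) ^+ 2) / (4 * eps).
    by rewrite ler_pM2r ?invr_gt0 ?mulr_gt0 //; nra.
  have h4 : 2 / (4 * eps) = 1 / (4 * eps) + 1 / (4 * eps) by field; rewrite gt_eqF.
  lra.
have Bb : B ^+ 2 <= L * (1 / (4 * eps)) * p ^+ 2.
  pose T := (rho + rho0) * ((eps + L * (rho ^+ 2 + rho0 ^+ 2)) * w0 - a * L).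
  have Tb : - excess_cst L a W <= T <= excess_cst L a W.
    have r2 : 0 <= rho ^+ 2 <= 2 by apply/andP; split; nra.
    have s2 : 0 <= rho0 ^+ 2 <= 2 by apply/andP; split; nra.
    have [g0 g1] : 0 <= eps + L * (rho ^+ 2 + rho0 ^+ 2) /\
       eps + L * (rho ^+ 2 + rho0 ^+ 2) <= 1 + 4 * L.
      by case/andP: r2 => ? ?; case/andP: s2 => ? ?; split; nra.
    rewrite /T; move: g0 g1; set G := eps + _ => g0 g1.
    have [k0 k1] : 0 <= rho + rho0 /\ rho + rho0 <= 4 by split; lra.
    move: k0 k1; set Z := rho + rho0 => k0 k1.
    have Gw : - (W * (1 + 4 * L)) <= G * w0 <= W * (1 + 4 * L).
      by apply/andP; split; nra.
    have aL : 0 <= a * L by nra.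
    rewrite /excess_cst; move: Gw => /andP[? ?].
    have WL : 0 <= W * (1 + 4 * L) by nra.
    by apply/andP; split; nra.
  have -> : B = p * T by rewrite /B /T; ring.
  rewrite exprMn mulrC ler_wpM2r ?sqr_ge0 //.
  rewrite mul1r ler_pdivlMr ?mulr_gt0 //.
  apply: le_trans c2; rewrite mulrC ler_pM2l ?mulr_gt0 //.
  move: Tb; move: T (excess_cst L a W) => t k /andP[tl tu].
  have k1 : 0 <= k - t by lra.
  have k2 : 0 <= k + t by lra.
  by have := mulr_ge0 k1 k2; lra.
have := quadratic_form_ge0 q L0 Bb.
have : 0 <= eps / 2 * (sg - r1) ^+ 2 by rewrite mulr_ge0 ?sqr_ge0 // divr_ge0 // ltW.
have : L / 4 * q ^+ 2 <= A * q ^+ 2 by rewrite ler_wpM2r ?sqr_ge0.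
have : 1 / (4 * eps) * p ^+ 2 <= D * p ^+ 2 by rewrite ler_wpM2r ?sqr_ge0.
lra.
Qed.

End Excess.

(** * Calibration *)

Section Calibration.
Context {R : realType}.
Notation mu := (@lebesgue_measure R).

(** The integrand of the energy, as a function of the values and derivatives of
    the two components. *)
Definition cartesian_density (L a eps v1 v2 d1 d2 : R) :=
  eps / 2 * (d1 ^+ 2 + d2 ^+ 2)
  + 1 / (4 * eps) * (Num.sqrt (v1 ^+ 2 + v2 ^+ 2) ^+ 2 - 1) ^+ 2
  + L / 2 * (v1 * d2 - v2 * d1 - a) ^+ 2.

Lemma cartesian_density_polar (L a eps v1 v2 d1 d2 : R) : 0 < v1 ^+ 2 + v2 ^+ 2 ->
  let rho := Num.sqrt (v1 ^+ 2 + v2 ^+ 2) in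
  cartesian_density L a eps v1 v2 d1 d2 =
  polar_density L a eps rho ((v1 * d1 + v2 * d2) / rho) ((v1 * d2 - v2 * d1) / rho ^+ 2).
Proof.
move=> v0 rho; have r2 : rho ^+ 2 = v1 ^+ 2 + v2 ^+ 2 by rewrite sqr_sqrtr // ltW.
have r0 : rho != 0 by rewrite gt_eqF // sqrtr_gt0.
rewrite /cartesian_density /polar_density -/rho.
have -> : rho ^+ 2 * ((v1 * d2 - v2 * d1) / rho ^+ 2) = v1 * d2 - v2 * d1 by field.
have -> : ((v1 * d1 + v2 * d2) / rho) ^+ 2
    + rho ^+ 2 * ((v1 * d2 - v2 * d1) / rho ^+ 2) ^+ 2 = d1 ^+ 2 + d2 ^+ 2.
  transitivity ((v1 ^+ 2 + v2 ^+ 2) / rho ^+ 2 * (d1 ^+ 2 + d2 ^+ 2)); first by field.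
  by rewrite -r2 divff ?mul1r // expf_neq0.
by [].
Qed.

Lemma cartesian_density_intg (L a eps : R) (v1 v2 d1 d2 : R -> R) :
  cont01 v1 -> cont01 v2 -> L2_01 d1 -> L2_01 d2 ->
  intg01 (fun x => cartesian_density L a eps (v1 x) (v2 x) (d1 x) (d2 x)).
Proof.
move=> c1 c2 l1 l2; apply: intg01D; first apply: intg01D.
- by apply: intg01Z; apply: intg01D; exact: (L2_intgM _ _).
- apply: intg01Z; apply: intg01_cont; apply: cont01X; apply: cont01B; last exact: cont01_cst.
  apply: cont01X; apply: (@cont01_comp _ _ Num.sqrt); last by move=> x _; exact: sqrt_continuous.
  by apply: cont01D; exact: cont01X.
- apply: intg01Z.
  have l : L2_01 (fun x => v1 x * d2 x - v2 x * d1 x - a).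
    by apply: L2_B; [apply: L2_B; exact: L2_M|exact/L2_cont/cont01_cst].
  exact: (L2_intgM l l).
Qed.

Lemma polar_density_cont (L a eps : R) (r r1 w : R -> R) :
  cont01 r -> cont01 r1 -> cont01 w ->
  cont01 (fun x => polar_density L a eps (r x) (r1 x) (w x)).
Proof.
move=> cr cr1 cw; rewrite /polar_density; apply: cont01D; first apply: cont01D.
- apply: cont01M; first exact: cont01_cst.
  by apply: cont01D; [exact: cont01X|apply: cont01M; exact: cont01X].
- apply: cont01M; first exact: cont01_cst.
  by apply: cont01X; apply: cont01B; [exact: cont01X|exact: cont01_cst].
- apply: cont01M; first exact: cont01_cst.
  apply: cont01X; apply: cont01B; last exact: cont01_cst.
  by apply: cont01M => //; exact: cont01X.
Qed.

Lemma ac01_sqrt (f g : R -> R) : ac01 f g -> (forall x, 0 <= x <= 1 -> 0 < f x) ->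
  ac01 (fun x => Num.sqrt (f x)) (fun x => (2 * Num.sqrt (f x))^-1 * g x).
Proof.
move=> fg f0; apply: (@ac01_comp R f g 0 Num.sqrt (fun t => (2 * Num.sqrt t)^-1)) => //.
move=> t t0; apply: cvgV; first by rewrite mulf_neq0 // gt_eqF // sqrtr_gt0.
by apply: cvgM; [exact: cvg_cst|exact: sqrt_continuous].
Qed.

Lemma ac01_inv (f g : R -> R) : ac01 f g -> (forall x, 0 <= x <= 1 -> 0 < f x) ->
  ac01 (fun x => (f x)^-1) (fun x => - (f x) ^- 2 * g x).
Proof.
move=> fg f0; apply: (@ac01_comp R f g 0 (fun t => t^-1) (fun t => - t ^- 2)) => //.
  move=> t t0; have := @is_deriveV R id t 1 1 _ (is_derive_id _ _).
  rewrite gt_eqF // => /(_ isT) /is_derive_eq; apply.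
  by rewrite /GRing.scale /= mulr1.
move=> t t0; apply: cvgN; apply: cvgV; first by rewrite expf_neq0 // gt_eqF.
exact: exprn_continuous.
Qed.

Lemma ac01_atan (f g : R -> R) : ac01 f g ->
  ac01 (fun x => atan (f x)) (fun x => (1 + f x ^+ 2)^-1 * g x).
Proof.
move=> fg; have [m m0 fm] := cont01_bounded (ac01_cont fg).
apply: (@ac01_comp R f g (- (m + 1)) (@atan R) (fun t => (1 + t ^+ 2)^-1)) => //.
- by move=> x /fm; rewrite ler_norml => /andP[]; lra.
- move=> t _; apply: cvgV; first by rewrite gt_eqF // ltr_pwDl // sqr_ge0.
  by apply: cvgD; [exact: cvg_cst|exact: exprn_continuous].
Qed.

(** With z = e^{-i theta} v and theta' = w, the angle atan (z2 / z1) of z moves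
    with the angular velocity of v minus w. The left-hand side is spelled as the
    quotient and chain rules produce it. *)
Lemma rotation_derivative (v1 v2 d1 d2 w c s : R) : c ^+ 2 + s ^+ 2 = 1 ->
  v1 * c + v2 * s != 0 -> v1 ^+ 2 + v2 ^+ 2 != 0 ->
  let z1 := v1 * c + v2 * s in let z2 := v2 * c - v1 * s in
  (1 + (z2 * z1^-1) ^+ 2)^-1 *
    ((d2 * c + v2 * (- s * w) - (d1 * s + v1 * (c * w))) * z1^-1
     + z2 * (- z1 ^- 2 * (d1 * c + v1 * (- s * w) + (d2 * s + v2 * (c * w)))))
  = (v1 * d2 - v2 * d1) / (v1 ^+ 2 + v2 ^+ 2) - w.
Proof.
move=> cs z10 v0 z1 z2.
have zz : z1 ^+ 2 + z2 ^+ 2 = v1 ^+ 2 + v2 ^+ 2.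
  by rewrite -[RHS]mulr1 -cs /z1 /z2; ring.
have -> : (1 + (z2 * z1^-1) ^+ 2)^-1 = z1 ^+ 2 / (v1 ^+ 2 + v2 ^+ 2).
  rewrite -zz; field; rewrite -/z1 in z10; rewrite z10 zz v0 //.
transitivity ((z1 * (d2 * c + v2 * (- s * w) - (d1 * s + v1 * (c * w)))
   - z2 * (d1 * c + v1 * (- s * w) + (d2 * s + v2 * (c * w)))) / (v1 ^+ 2 + v2 ^+ 2)).
  by field; rewrite v0.
transitivity ((v1 * d2 - v2 * d1 - w * (v1 ^+ 2 + v2 ^+ 2)) * (c ^+ 2 + s ^+ 2)
   / (v1 ^+ 2 + v2 ^+ 2)).
  by congr (_ / _); rewrite /z1 /z2; ring.
by rewrite cs; field.
Qed.

(** A solution of the Euler-Lagrange equations minimizes the energy among all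
    maps with the same end values that stay close to it in the sup norm. Let
      Phi = eps r' (|v| - r) + C arg (e^{-i th} v).
    By the equations, the tangent inequality of polar_density_convex reads:
    density of v >= density of u + Phi'. Closeness lets the argument be
    computed as atan (z2 / z1) with z1 > 0, so Phi is absolutely continuous,
    and it vanishes at both ends. *)
Lemma calibration (L a W eps C : R) (r r1 r2 th w v1 v2 d1 d2 : R -> R) :
  0 < L -> 0 <= a -> 0 < eps -> eps <= 1 ->
  4 * eps * (a * L * W) <= 1 -> 4 * eps * (excess_cst L a W) ^+ 2 <= L ->
  (forall x : R, 0 <= x <= 1 -> is_derive x (1 : R) r (r1 x)) ->
  (forall x : R, 0 <= x <= 1 -> is_derive x (1 : R) r1 (r2 x)) ->
  (forall x : R, 0 <= x <= 1 -> is_derive x (1 : R) th (w x)) ->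
  cont01 r2 -> cont01 w ->
  (forall x, 0 <= x <= 1 -> 95 / 100 <= r x <= 105 / 100) ->
  (forall x, 0 <= x <= 1 -> `|w x| <= W) ->
  (forall x, 0 <= x <= 1 -> eps * r2 x = radial_force L a eps (r x) (w x)) ->
  (forall x, 0 <= x <= 1 -> angular_momentum L a eps (r x) (w x) = C) ->
  r 0 = 1 -> r 1 = 1 ->
  ac01 v1 d1 -> ac01 v2 d2 -> L2_01 d1 -> L2_01 d2 ->
  v1 0 = cos (th 0) -> v2 0 = sin (th 0) -> v1 1 = cos (th 1) -> v2 1 = sin (th 1) ->
  (forall x, 0 <= x <= 1 -> `|v1 x - r x * cos (th x)| <= 1 / 40) ->
  (forall x, 0 <= x <= 1 -> `|v2 x - r x * sin (th x)| <= 1 / 40) ->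
  \int[mu]_(x in `[0, 1]) polar_density L a eps (r x) (r1 x) (w x) <=
  \int[mu]_(x in `[0, 1]) cartesian_density L a eps (v1 x) (v2 x) (d1 x) (d2 x).
Proof.
move=> L0 a0 e0 e1 h1 h2 dr dr1 dth cr2 cw rb wb EL1 EL2 r_0 r_1 av1 av2 l1 l2
  v10 v20 v11 v21 n1 n2.
have cont_of f g : (forall x : R, 0 <= x <= 1 -> is_derive x (1 : R) f (g x)) -> cont01 f.
  by move=> d; apply: cont01_pt => x /d /is_derive_cont.
have cr1 := cont_of _ _ dr1; have cr := cont_of _ _ dr; have cth := cont_of _ _ dth.
have ccos : cont01 (fun x => cos (th x)).
  by apply: (cont01_comp cth) => x _; exact: continuous_cos.
have csin : cont01 (fun x => sin (th x)).
  by apply: (cont01_comp cth) => x _; exact: continuous_sin.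
have acos : ac01 (fun x => cos (th x)) (fun x => - sin (th x) * w x).
  apply: ac01_C1; last by apply: cont01M => //; exact: cont01N.
  by move=> x x01; apply: is_derive_fun_comp; exact: dth.
have asin : ac01 (fun x => sin (th x)) (fun x => cos (th x) * w x).
  apply: ac01_C1; last by apply: cont01M.
  by move=> x x01; apply: is_derive_fun_comp; exact: dth.
have ar : ac01 r r1 by apply: ac01_C1.
have ar1 : ac01 r1 r2 by apply: ac01_C1.
(* z = e^{-i th} v, which stays close to the positive number r *)
pose z1 x := v1 x * cos (th x) + v2 x * sin (th x).
pose z2 x := v2 x * cos (th x) - v1 x * sin (th x).
have az1 := ac01D (ac01M av1 acos) (ac01M av2 asin).
have az2 := ac01B (ac01M av2 acos) (ac01M av1 asin).
have cs x : cos (th x) ^+ 2 + sin (th x) ^+ 2 = 1 by exact: cos2Dsin2.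
have zz x : z1 x ^+ 2 + z2 x ^+ 2 = v1 x ^+ 2 + v2 x ^+ 2.
  transitivity ((v1 x ^+ 2 + v2 x ^+ 2) * (cos (th x) ^+ 2 + sin (th x) ^+ 2)).
    by rewrite /z1 /z2; ring.
  by rewrite cs mulr1.
have prodb (u c : R) : `|u| <= 1 / 40 -> `|c| <= 1 -> `|u * c| <= 1 / 40.
  by move=> u1 c1; rewrite normrM; have := normr_ge0 u; have := normr_ge0 c; nra.
have z1b x : 0 <= x <= 1 -> 9 / 10 <= z1 x <= 11 / 10.
  move=> x01; have /andP[ra rb'] := rb x x01.
  have -> : z1 x = r x + (v1 x - r x * cos (th x)) * cos (th x)
                       + (v2 x - r x * sin (th x)) * sin (th x).
    transitivity (z1 x + r x * (1 - (cos (th x) ^+ 2 + sin (th x) ^+ 2))).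
      by rewrite cs subrr mulr0 addr0.
    by rewrite /z1; ring.
  have := prodb _ _ (n1 x x01) (cos_max (th x)).
  have := prodb _ _ (n2 x x01) (sin_max (th x)).
  by rewrite !ler_norml => /andP[? ?] /andP[? ?]; lra.
have z2b x : 0 <= x <= 1 -> `|z2 x| <= 1 / 20.
  move=> x01.
  have -> : z2 x = (v2 x - r x * sin (th x)) * cos (th x)
                       - (v1 x - r x * cos (th x)) * sin (th x).
    by rewrite /z2; ring.
  apply: le_trans (ler_normB _ _) _.
  have := prodb _ _ (n1 x x01) (sin_max (th x)).
  have := prodb _ _ (n2 x x01) (cos_max (th x)); lra.
have s0 x : 0 <= x <= 1 -> 0 < v1 x ^+ 2 + v2 x ^+ 2.
  by move=> /z1b /andP[? _]; rewrite -zz; have := sqr_ge0 (z2 x); nra.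
pose rho x := Num.sqrt (v1 x ^+ 2 + v2 x ^+ 2).
have rho2 x : rho x ^+ 2 = v1 x ^+ 2 + v2 x ^+ 2.
  by rewrite sqr_sqrtr // addr_ge0 // sqr_ge0.
have rhob x : 0 <= x <= 1 -> 9 / 10 <= rho x <= 12 / 10.
  move=> x01; have /andP[? ?] := z1b x x01; have := z2b x x01.
  rewrite ler_norml => /andP[? ?].
  have := rho2 x; have : 0 <= rho x by exact: sqrtr_ge0.
  by rewrite -zz => ? E; apply/andP; split; nra.
have arho := ac01_sqrt (ac01D (ac01_sqr av1) (ac01_sqr av2)) s0.
have z10 x : 0 <= x <= 1 -> 0 < z1 x by move=> /z1b /andP[? _]; lra.
have aat := ac01_atan (ac01M az2 (ac01_inv az1 z10)).
have aPhi := ac01D (ac01Z eps (ac01M ar1 (ac01B arho ar))) (ac01Z C aat).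
set Phi := (X in ac01 X _) in aPhi.
set dPhi := (X in ac01 _ X) in aPhi.
have P0 : Phi 0 = 0.
  rewrite /Phi v10 v20 r_0 cos2Dsin2 sqrtr1 subrr mulr0 mulr0 add0r.
  by rewrite (mulrC (sin _)) subrr mul0r atan0 mulr0.
have P1 : Phi 1 = 0.
  rewrite /Phi v11 v21 r_1 cos2Dsin2 sqrtr1 subrr mulr0 mulr0 add0r.
  by rewrite (mulrC (sin _)) subrr mul0r atan0 mulr0.
have ip := intg01_cont (@polar_density_cont L a eps _ _ _ cr cr1 cw).
have iE := cartesian_density_intg L a eps (ac01_cont av1) (ac01_cont av2) l1 l2.
have -> : \int[mu]_(x in `[0, 1]) polar_density L a eps (r x) (r1 x) (w x) =
    \int[mu]_(x in `[0, 1]) (polar_density L a eps (r x) (r1 x) (w x) + dPhi x).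
  rewrite [RHS]RintegralD //; last exact: aPhi.1.
  by rewrite (ac01_int aPhi) P0 P1 subrr addr0.
apply: le_Rintegral => //; first exact: (intg01D ip aPhi.1).
move=> x; rewrite /= in_itv /= => x01.
rewrite cartesian_density_polar; last exact: s0.
have := @polar_density_convex R L a W eps (rho x) (r x)
  ((v1 x * d1 x + v2 x * d2 x) / rho x) (r1 x)
  ((v1 x * d2 x - v2 x * d1 x) / rho x ^+ 2) (w x)
  L0 a0 e0 e1 (rhob x x01) (rb x x01) (wb x x01) h1 h2.
apply: le_trans; rewrite EL2 // -EL1 // -!addrA lerD2l.
rewrite le_eqVlt; apply/orP; left; apply/eqP.
have r0 : rho x != 0 by have /andP[? _] := rhob x x01; rewrite gt_eqF //; lra.
have v0 : v1 x ^+ 2 + v2 x ^+ 2 != 0 by rewrite -rho2 expf_neq0.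
have zx0 : v1 x * cos (th x) + v2 x * sin (th x) != 0 by rewrite gt_eqF // z10.
have := rotation_derivative (d1 x) (d2 x) (w x) (cs x) zx0 v0.
rewrite /dPhi => ->.
rewrite -/(rho x) rho2 mulrDr.
rewrite (_ : (2 * rho x)^-1 * (2 * v1 x * d1 x + 2 * v2 x * d2 x)
   = (v1 x * d1 x + v2 x * d2 x) / rho x); last by field.
by ring.
Qed.
End Calibration.

(** * Critical points are local minimizers *)

Section LocalMinimality.
Context {R : realType}.
Notation mu := (@lebesgue_measure R).

Lemma int01_cst (c : R) : \int[mu]_(_ in `[0, 1]) c = c.
Proof.
rewrite Rintegral_cst //= lebesgue_measure_itv /= lte_fin ltr01 oppr0 adde0 /=.
by rewrite mulr1.
Qed.

Lemma weak_derivativeP (f : R -> R) : H1_01 f ->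
  is_weak_derivative f (weak_derivative f).
Proof. by move=> [_ [g fg]]; rewrite /weak_derivative; case: xgetP => // /(_ g). Qed.

Lemma H1_ac01 (f : R -> R) : H1_01 f -> ac01 f (weak_derivative f).
Proof. by move=> hf; apply: weak_derivative_ac01; [exact: hf.1|exact: weak_derivativeP]. Qed.

Lemma H1_L2 (f : R -> R) : H1_01 f -> L2_01 (weak_derivative f).
Proof. by move=> /weak_derivativeP[]. Qed.

Lemma ac01_H1 (f g : R -> R) : ac01 f g -> L2_01 g -> H1_01 f.
Proof. by move=> fg lg; split; [exact: ac01_cont fg|exists g; exact: ac01_weak_derivative]. Qed.

Lemma H1_B (f g : R -> R) : H1_01 f -> H1_01 g -> H1_01 (fun x => f x - g x).
Proof.
move=> hf hg; apply: ac01_H1 (ac01B (H1_ac01 hf) (H1_ac01 hg)) _.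
by apply: L2_B; exact: H1_L2.
Qed.

Lemma energyE (L : R) N eps u : energy L N eps u =
  \int[mu]_(x in `]0, 1[) cartesian_density L (2 * pi * N%:R) eps (re_part u x) (im_part u x)
     (weak_derivative (re_part u) x) (weak_derivative (im_part u) x).
Proof. by []. Qed.

(** The energy may be computed with any representative of the derivatives. *)
Lemma energy_ac01 (L : R) N eps (u : R -> R * R) (d1 d2 : R -> R) :
  ac01 (re_part u) d1 -> ac01 (im_part u) d2 -> L2_01 d1 -> L2_01 d2 ->
  energy L N eps u = \int[mu]_(x in `[0, 1])
    cartesian_density L (2 * pi * N%:R) eps (re_part u x) (im_part u x) (d1 x) (d2 x).
Proof.
move=> a1 a2 l1 l2; have h1 := ac01_H1 a1 l1; have h2 := ac01_H1 a2 l2.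
have c1 := ac01_cont a1; have c2 := ac01_cont a2.
have i := cartesian_density_intg L (2 * pi * N%:R) eps c1 c2.
have i1 := i _ _ (H1_L2 h1) (H1_L2 h2).
have i2 := i _ _ l1 l2.
rewrite energyE -(int01_oo i2) /Rintegral; congr fine.
apply: ae_eq_integral => //.
- by move/intg01_ooP : i1 => /integrableP[].
- by move/intg01_ooP : i2 => /integrableP[].
have := ac01_unique (H1_ac01 h1) a1; have := ac01_unique (H1_ac01 h2) a2.
apply: filterS2 => x e2 e1 x01.
by rewrite e1 // e2.
Qed.

(** The one-dimensional Sobolev embedding for functions vanishing at 0, from
    |g| <= r / 2 + g^2 / (2 r). *)
Lemma sobolev_bound (w : R -> R) (r : R) : 0 < r -> H1_01 w -> w 0 = 0 ->
  \int[mu]_(x in `[0, 1]) (weak_derivative w x ^+ 2) <= r ^+ 2 ->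
  forall x, 0 <= x <= 1 -> `|w x| <= r.
Proof.
move=> r0 hw w0 wr x /andP[x0 x1].
have [gi _] := H1_ac01 hw; have := H1_L2 hw; rewrite L2_01P => -[_ g2].
set g := weak_derivative w in gi g2 wr *.
rewrite -[w x]subr0 -w0 (ac01_diff (H1_ac01 hw)) // -/g.
apply: le_trans (le_normr_Rintegral _ _) _ => //; first exact: intg01_sub.
apply: le_trans (_ : \int[mu]_(t in `[0, 1]) `|g t| <= _).
  rewrite -subr_ge0.
  have := int_diff (intg01_norm gi) x0 x1 (lexx 1) => ->.
  exact: Rintegral_ge0.
apply: le_trans (_ : \int[mu]_(t in `[0, 1]) (r / 2 + (2 * r)^-1 * g t ^+ 2) <= _).
  apply: le_Rintegral => //; first exact: (intg01_norm gi).
    by apply: intg01D; [exact: intg01_cst|exact: intg01Z].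
  move=> t _; rewrite -(ler_pM2l (_ : 0 < 2 * r)) ?mulr_gt0 //.
  have -> y : 2 * r * (r / 2 + (2 * r)^-1 * y) = r ^+ 2 + y.
    by field; rewrite gt_eqF.
  rewrite -[g t ^+ 2]real_normK ?num_real //.
  by have := sqr_ge0 (r - `|g t|); nra.
rewrite RintegralD //; [|exact: intg01_cst|exact: intg01Z].
rewrite int01_cst RintegralZl //.
rewrite -(ler_pM2l (_ : 0 < 2 * r)) ?mulr_gt0 //.
have -> y : 2 * r * (r / 2 + (2 * r)^-1 * y) = r ^+ 2 + y.
  by field; rewrite gt_eqF.
lra.
Qed.

Lemma H1_norm_bound (u v : R -> R * R) (r : R) : 0 < r ->
  H1_01_R2 u -> H1_01_R2 v -> u 0 = v 0 ->
  H1_norm (fun x => (re_part v x - re_part u x, im_part v x - im_part u x)) < r ->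
  forall x, 0 <= x <= 1 ->
    `|re_part v x - re_part u x| <= r /\ `|im_part v x - im_part u x| <= r.
Proof.
move=> r0 [hu1 hu2] [hv1 hv2] uv.
have h1 := H1_B hv1 hu1; have h2 := H1_B hv2 hu2.
set w1 := (fun x => re_part v x - re_part u x) in h1 *.
set w2 := (fun x => im_part v x - im_part u x) in h2 *.
rewrite /H1_norm.
have -> : re_part (fun x => (re_part v x - re_part u x, im_part v x - im_part u x)) = w1 by [].
have -> : im_part (fun x => (re_part v x - re_part u x, im_part v x - im_part u x)) = w2 by [].
have sq (w : R -> R) : H1_01 w -> intg01 (fun x => w x ^+ 2) /\ intg01 (fun x => weak_derivative w x ^+ 2).
  move=> hw; split; first by apply: intg01_cont; apply: cont01X; exact: hw.1.
  by have := H1_L2 hw; rewrite L2_01P => -[].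
have [i1 j1] := sq _ h1; have [i2 j2] := sq _ h2.
have ii := intg01D (intg01D (intg01D i1 i2) j1) j2.
rewrite int01_oo //.
set I := Rintegral _ _ _ => Ir.
have I0 : 0 <= I by apply: Rintegral_ge0 => x _; rewrite !addr_ge0 // sqr_ge0.
have Ir2 : I <= r ^+ 2.
  rewrite -(sqr_sqrtr I0) ler_sqr ?nnegrE ?sqrtr_ge0 ?(ltW r0) //; exact: ltW.
have b1 : \int[mu]_(x in `[0, 1]) (weak_derivative w1 x ^+ 2) <= r ^+ 2.
  apply: le_trans Ir2; apply: le_Rintegral => // x _.
  have := sqr_ge0 (w1 x); have := sqr_ge0 (w2 x); have := sqr_ge0 (weak_derivative w2 x); lra.
have b2 : \int[mu]_(x in `[0, 1]) (weak_derivative w2 x ^+ 2) <= r ^+ 2.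
  apply: le_trans Ir2; apply: le_Rintegral => // x _.
  have := sqr_ge0 (w1 x); have := sqr_ge0 (w2 x); have := sqr_ge0 (weak_derivative w1 x); lra.
have z1 : w1 0 = 0 by rewrite /w1 /re_part uv subrr.
have z2 : w2 0 = 0 by rewrite /w2 /im_part uv subrr.
by move=> x x01; split; [exact: (sobolev_bound r0 h1 z1 b1)|exact: (sobolev_bound r0 h2 z2 b2)].
Qed.

(** The components of an admissible map at H^1 distance less than 1/40 from u are
    within 1/40 of those of u in the sup norm, so the calibration applies. *)
Lemma EL_local_minimizer (L W eps C beta : R) (N : nat) (r r1 r2 th w : R -> R) :
  let a := 2 * pi * N%:R in
  let u := fun x => (r x * cos (th x), r x * sin (th x)) in
  0 < L -> 0 < eps -> eps <= 1 ->
  4 * eps * (a * L * W) <= 1 -> 4 * eps * (excess_cst L a W) ^+ 2 <= L ->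
  (forall x : R, 0 <= x <= 1 -> is_derive x (1 : R) r (r1 x)) ->
  (forall x : R, 0 <= x <= 1 -> is_derive x (1 : R) r1 (r2 x)) ->
  (forall x : R, 0 <= x <= 1 -> is_derive x (1 : R) th (w x)) ->
  cont01 r2 -> cont01 w ->
  (forall x, 0 <= x <= 1 -> 95 / 100 <= r x <= 105 / 100) ->
  (forall x, 0 <= x <= 1 -> `|w x| <= W) ->
  (forall x, 0 <= x <= 1 -> eps * r2 x = radial_force L a eps (r x) (w x)) ->
  (forall x, 0 <= x <= 1 -> angular_momentum L a eps (r x) (w x) = C) ->
  r 0 = 1 -> r 1 = 1 -> th 0 = 0 -> th 1 = beta ->
  H1_local_minimizer L N beta eps u /\
  energy L N eps u = \int[mu]_(x in `[0, 1]) polar_density L a eps (r x) (r1 x) (w x).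
Proof.
move=> a u L0 e0 e1 h1 h2 dr dr1 dth cr2 cw rb wb EL1 EL2 r_0 r_1 th0 th1.
have a0 : 0 <= a by rewrite !mulr_ge0 // pi_ge0.
have cont_of (f g : R -> R) : (forall x : R, 0 <= x <= 1 -> is_derive x (1 : R) f (g x)) -> cont01 f.
  by move=> d; apply: cont01_pt => x /d /is_derive_cont.
have cr1 := cont_of _ _ dr1; have cr := cont_of _ _ dr; have cth := cont_of _ _ dth.
have ccos : cont01 (fun x => cos (th x)).
  by apply: (cont01_comp cth) => x _; exact: continuous_cos.
have csin : cont01 (fun x => sin (th x)).
  by apply: (cont01_comp cth) => x _; exact: continuous_sin.
pose d1 x := r1 x * cos (th x) + r x * (- sin (th x) * w x).
pose d2 x := r1 x * sin (th x) + r x * (cos (th x) * w x).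
have cd1 : cont01 d1.
  apply: cont01D; apply: cont01M => //; apply: cont01M => //; exact: cont01N.
have cd2 : cont01 d2.
  by apply: cont01D; apply: cont01M => //; apply: cont01M.
have a1 : ac01 (re_part u) d1.
  apply: ac01_C1 => // x x01; apply: is_derive_funM; first exact: dr.
  by apply: is_derive_fun_comp; exact: dth.
have a2 : ac01 (im_part u) d2.
  apply: ac01_C1 => // x x01; apply: is_derive_funM; first exact: dr.
  by apply: is_derive_fun_comp; exact: dth.
have l1 := L2_cont cd1; have l2 := L2_cont cd2.
have E : energy L N eps u = \int[mu]_(x in `[0, 1]) polar_density L a eps (r x) (r1 x) (w x).
  rewrite (energy_ac01 L N eps a1 a2 l1 l2).
  apply: eq_Rintegral => x; rewrite inE /= in_itv /= => x01.
  have /andP[rx _] := rb x x01.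
  have cs := cos2Dsin2 (th x).
  have e : (r x * cos (th x)) ^+ 2 + (r x * sin (th x)) ^+ 2 = r x ^+ 2.
    by rewrite !exprMn -mulrDr cs mulr1.
  have rx0 : 0 < r x by lra.
  have r0 : r x != 0 by rewrite gt_eqF.
  rewrite cartesian_density_polar /re_part /im_part /= e ?exprn_gt0 //.
  rewrite sqrtr_sqr gtr0_norm //.
  congr polar_density.
    transitivity (r1 x * (cos (th x) ^+ 2 + sin (th x) ^+ 2)); last by rewrite cs mulr1.
    by rewrite /d1 /d2; field.
  transitivity (w x * (cos (th x) ^+ 2 + sin (th x) ^+ 2)); last by rewrite cs mulr1.
  by rewrite /d1 /d2; field.
have Hu : H1_01_R2 u by split; [exact: ac01_H1 a1 l1|exact: ac01_H1 a2 l2].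
have u0 : u 0 = (1, 0) by rewrite /u r_0 th0 cos0 sin0 !mul1r.
split => //; split.
  by split => //; rewrite /u r_1 th1 !mul1r.
exists (1 / 40); first by rewrite divr_gt0.
move=> v [Hv v0 v1] /(H1_norm_bound (divr_gt0 ltr01 (ltr0n R 40)) Hu Hv (etrans u0 (esym v0))) vu.
have av1 := H1_ac01 Hv.1; have av2 := H1_ac01 Hv.2.
have lv1 := H1_L2 Hv.1; have lv2 := H1_L2 Hv.2.
rewrite E (energy_ac01 L N eps av1 av2 lv1 lv2).
apply: (@calibration R L a W eps C r r1 r2 th w) => //.
- by rewrite /re_part v0 th0 cos0.
- by rewrite /im_part v0 th0 sin0.
- by rewrite /re_part v1 th1.
- by rewrite /im_part v1 th1.
- by move=> x /vu[].
- by move=> x /vu[].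
Qed.

End LocalMinimality.

(** * The Green operator of the linearized radial equation *)

Section Primitive.
Context {R : realType}.
Notation mu := (@lebesgue_measure R).
Implicit Types (f g : R -> R) (x : R).

(** Integrating from -1 makes the primitive differentiable on both sides at
    every point of [0, 1], the endpoints included. *)
Definition prim f x :=
  \int[mu]_(t in `[-1, x]) f t - \int[mu]_(t in `[-1, 0]) f t.

Lemma prim0 f : prim f 0 = 0.
Proof. by rewrite /prim subrr. Qed.

Lemma cont_integrable f (a b : R) : continuous f -> mu.-integrable `[a, b] (EFin \o f).
Proof.
move=> cf; apply: continuous_compact_integrable; first exact: segment_compact.
exact: continuous_subspaceT.
Qed.

Lemma is_derive_prim f x : continuous f -> 0 <= x <= 1 ->
  is_derive x (1 : R) (prim f) (f x).
Proof.
move=> cf /andP[x0 x1].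
have x2 : x < 2 by apply: le_lt_trans x1 _; rewrite ltr1n.
have ax : -1 < x by apply: lt_le_trans x0; rewrite ltrN10.
have [D E] := continuous_FTC1_closed x2 (@cont_integrable f (-1) 2 cf) ax (cf x).
have H : is_derive x (1 : R) (fun y => \int[mu]_(t in `[-1, y]) f t) (f x).
  by constructor; [exact: D|rewrite -derive1E].
have := is_derive_funB H (is_derive_cst (\int[mu]_(t in `[-1, 0]) f t) x 1).
by rewrite subr0.
Qed.

Lemma primB f g x : continuous f -> continuous g ->
  prim (fun t => f t - g t) x = prim f x - prim g x.
Proof.
move=> cf cg; rewrite /prim !RintegralB //; try exact: cont_integrable.
by ring.
Qed.

Lemma ac01_dom f f' g g' x y : ac01 f f' -> ac01 g g' ->
  (forall t, 0 <= t <= 1 -> `|f' t| <= g' t) -> 0 <= x -> x <= y -> y <= 1 ->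
  `|f y - f x| <= g y - g x.
Proof.
move=> af ag fg x0 xy y1; rewrite (ac01_diff af) // (ac01_diff ag) //.
apply: le_trans (le_normr_Rintegral _ _) _ => //; first exact: intg01_sub af.1 _ _.
apply: le_Rintegral => //.
- exact: (intg01_sub (intg01_norm af.1)).
- exact: (intg01_sub ag.1).
move=> t; rewrite /= in_itv /= => /andP[xt ty]; apply: fg.
by rewrite (le_trans x0 xt) (le_trans ty y1).
Qed.

(** The retraction of the line onto [0, 1]. Composing with it turns functions on
    [0, 1] into globally continuous ones with the same sup norm. *)
Definition clamp x : R := pos (1 - pos (1 - x)).

Lemma clamp_cont : continuous clamp.
Proof.
have c : continuous (fun t : R => pos (1 - t)).
  move=> x; apply: (@cvg_comp _ _ _ (fun t => 1 - t)); last exact: pos_cont.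
  by apply: cvgB; [exact: cvg_cst|exact: cvg_id].
by move=> x; apply: (@cvg_comp _ _ _ (fun t => pos (1 - t)) (fun t => pos (1 - t)) _ _ _ (c x) (c _)).
Qed.

Lemma clamp01 x : 0 <= clamp x <= 1.
Proof.
rewrite /clamp /pos /Num.max; case: (ltP 0 (1 - x)) => h1.
  by case: ltP; lra.
by rewrite subr0 ltr01 ler01 lexx.
Qed.

Lemma clamp_id x : 0 <= x <= 1 -> clamp x = x.
Proof.
by move=> /andP[x0 x1]; rewrite /clamp /pos !max_r; lra.
Qed.

Lemma comp_clamp_cont f : cont01 f -> continuous (f \o clamp).
Proof.
move=> /cont01P cf x; apply/cvgrPdist_lt => e e0.
have [d d0 Hd] := cf (clamp x) (clamp01 x) e e0.
have /cvgrPdist_lt /(_ d d0) := @clamp_cont x.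
apply: filterS => y yx /=; rewrite distrC; apply: Hd; first exact: clamp01.
by rewrite distrC.
Qed.

End Primitive.

Section Green.
Context {R : realType}.
Implicit Types (f g : R -> R) (x k : R).

Definition sinh x := 2^-1 * (expR x - expR (- x)).
Definition cosh x := 2^-1 * (expR x + expR (- x)).

Lemma is_derive_expN x : is_derive x (1 : R) (fun t => expR (- t)) (- expR (- x)).
Proof.
have := is_derive_fun_comp (is_derive_expR (- x)) (is_derive_funN (is_derive_id x (1 : R))).
by rewrite mulrN1.
Qed.

Lemma is_derive_sinh x : is_derive x (1 : R) sinh (cosh x).
Proof.
have := is_derive_funZ 2^-1 (is_derive_funB (is_derive_expR x) (is_derive_expN x)).
by rewrite opprK.
Qed.

Lemma is_derive_cosh x : is_derive x (1 : R) cosh (sinh x).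
Proof.
exact: (is_derive_funZ 2^-1 (is_derive_funD (is_derive_expR x) (is_derive_expN x))).
Qed.

Lemma sinhD x y : sinh (x + y) = sinh x * cosh y + cosh x * sinh y.
Proof. rewrite /sinh /cosh opprD !expRD; by field. Qed.

Lemma coshD x y : cosh (x + y) = cosh x * cosh y + sinh x * sinh y.
Proof. rewrite /sinh /cosh opprD !expRD; by field. Qed.

Lemma sinh0 : sinh 0 = 0 :> R.
Proof. by rewrite /sinh oppr0 subrr mulr0. Qed.

Lemma cosh0 : cosh 0 = 1 :> R.
Proof. by rewrite /cosh oppr0 expR0; field. Qed.

Lemma cosh_gt0 x : 0 < cosh x.
Proof. by rewrite /cosh mulr_gt0 // ?invr_gt0 // addr_gt0 // expR_gt0. Qed.

Lemma sinh_ge0 x : 0 <= x -> 0 <= sinh x.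
Proof. by move=> x0; rewrite /sinh mulr_ge0 ?invr_ge0 // subr_ge0 ler_expR; lra. Qed.

Lemma sinh_gt0 x : 0 < x -> 0 < sinh x.
Proof. by move=> x0; rewrite /sinh mulr_gt0 ?invr_gt0 // subr_gt0 ltr_expR; lra. Qed.

Lemma cosh_le_2sinh x : 1 <= x -> cosh x <= 2 * sinh x.
Proof.
move=> x1; rewrite /cosh /sinh.
have h : 1 + (x + x) <= expR (x + x) by exact: expR_ge1Dx.
have e0 : 0 < expR (- x) by exact: expR_gt0.
have E : expR x = expR (x + x) * expR (- x) by rewrite -expRD addrK.
rewrite E; nra.
Qed.

Definition sinh_l k x := sinh (k * x).
Definition sinh_r k x := sinh (k * (1 - x)).
Definition cosh_l k x := cosh (k * x).
Definition cosh_r k x := cosh (k * (1 - x)).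

Lemma is_derive_lin k x : is_derive x (1 : R) (fun t => k * t) k.
Proof. by have := is_derive_funZ k (is_derive_id x (1 : R)); rewrite mulr1. Qed.

Lemma is_derive_linr k x : is_derive x (1 : R) (fun t => k * (1 - t)) (- k).
Proof.
have := is_derive_funZ k (is_derive_funB (is_derive_cst (1 : R) x (1 : R)) (is_derive_id x (1 : R))).
by rewrite sub0r mulrN1.
Qed.

Lemma is_derive_sinh_l k x : is_derive x (1 : R) (sinh_l k) (k * cosh_l k x).
Proof. by have := is_derive_fun_comp (is_derive_sinh _) (is_derive_lin k x); rewrite mulrC. Qed.
Lemma is_derive_sinh_r k x : is_derive x (1 : R) (sinh_r k) (- k * cosh_r k x).
Proof. by have := is_derive_fun_comp (is_derive_sinh _) (is_derive_linr k x); rewrite mulrC. Qed.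
Lemma is_derive_cosh_l k x : is_derive x (1 : R) (cosh_l k) (k * sinh_l k x).
Proof. by have := is_derive_fun_comp (is_derive_cosh _) (is_derive_lin k x); rewrite mulrC. Qed.
Lemma is_derive_cosh_r k x : is_derive x (1 : R) (cosh_r k) (- k * sinh_r k x).
Proof. by have := is_derive_fun_comp (is_derive_cosh _) (is_derive_linr k x); rewrite mulrC. Qed.

Lemma sinh_l_cont k : continuous (sinh_l k).
Proof. by move=> x; have /is_derive_cont := is_derive_sinh_l k x. Qed.
Lemma sinh_r_cont k : continuous (sinh_r k).
Proof. by move=> x; have /is_derive_cont := is_derive_sinh_r k x. Qed.

Definition mass_l k f := prim (fun t => sinh_l k t * f t).
Definition mass_r k f x := prim (fun t => sinh_r k t * f t) 1 - prim (fun t => sinh_r k t * f t) x.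

(** The solution of y'' = k^2 (y + f) with y 0 = y 1 = 0, by variation of
    constants. *)
Definition green k f x := - (k / sinh k) * (sinh_r k x * mass_l k f x + sinh_l k x * mass_r k f x).
Definition dgreen k f x :=
  - (k ^+ 2 / sinh k) * (cosh_l k x * mass_r k f x - cosh_r k x * mass_l k f x).

Lemma cont_mul (f g : R -> R) : continuous f -> continuous g -> continuous (fun t => f t * g t).
Proof. by move=> cf cg x; apply: cvgM; [exact: cf|exact: cg]. Qed.

Lemma is_derive_mass_l k f x : continuous f -> 0 <= x <= 1 ->
  is_derive x (1 : R) (mass_l k f) (sinh_l k x * f x).
Proof. by move=> cf; apply: is_derive_prim; apply: cont_mul => //; exact: sinh_l_cont. Qed.

Lemma is_derive_mass_r k f x : continuous f -> 0 <= x <= 1 ->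
  is_derive x (1 : R) (mass_r k f) (- (sinh_r k x * f x)).
Proof.
move=> cf x01; have c := cont_mul (@sinh_r_cont k) cf.
have := is_derive_funB (is_derive_cst (prim (fun t => sinh_r k t * f t) 1) x (1 : R))
  (is_derive_prim c x01).
by rewrite sub0r.
Qed.

Lemma is_derive_green k f x : continuous f -> 0 <= x <= 1 ->
  is_derive x (1 : R) (green k f) (dgreen k f x).
Proof.
move=> cf x01.
have := is_derive_funZ (- (k / sinh k)) (is_derive_funD
  (is_derive_funM (is_derive_sinh_r k x) (is_derive_mass_l k cf x01))
  (is_derive_funM (is_derive_sinh_l k x) (is_derive_mass_r k cf x01))).
by move=> /is_derive_eq; apply; rewrite /dgreen; ring.
Qed.

Lemma wronskian k x : sinh_r k x * cosh_l k x + cosh_r k x * sinh_l k x = sinh k.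
Proof. by rewrite -sinhD -mulrDr subrK mulr1. Qed.

Lemma is_derive_dgreen k f x : 0 < k -> continuous f -> 0 <= x <= 1 ->
  is_derive x (1 : R) (dgreen k f) (k ^+ 2 * (green k f x + f x)).
Proof.
move=> k0 cf x01.
have := is_derive_funZ (- (k ^+ 2 / sinh k)) (is_derive_funB
  (is_derive_funM (is_derive_cosh_l k x) (is_derive_mass_r k cf x01))
  (is_derive_funM (is_derive_cosh_r k x) (is_derive_mass_l k cf x01))).
move=> /is_derive_eq; apply; rewrite /green.
have s0 : sinh k != 0 by rewrite gt_eqF // sinh_gt0.
transitivity (k ^+ 2 / sinh k * (- k * (sinh_r k x * mass_l k f x + sinh_l k x * mass_r k f x)
   + f x * (sinh_r k x * cosh_l k x + cosh_r k x * sinh_l k x))).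
  by field.
by rewrite wronskian; field.
Qed.

Lemma green0 k f : green k f 0 = 0.
Proof. by rewrite /green /mass_l prim0 /sinh_l !mulr0 sinh0 mul0r addr0 mulr0. Qed.

Lemma green1 k f : green k f 1 = 0.
Proof. by rewrite /green /mass_r /sinh_r !subrr !mulr0 sinh0 mul0r addr0 mulr0. Qed.

Lemma greenB k f g x : continuous f -> continuous g ->
  green k (fun t => f t - g t) x = green k f x - green k g x.
Proof.
move=> cf cg; have cl1 := @sinh_l_cont k; have cr1 := @sinh_r_cont k.
have P (s : R -> R) y : continuous s -> prim (fun t => s t * (f t - g t)) y =
    prim (fun t => s t * f t) y - prim (fun t => s t * g t) y.
  move=> cs; rewrite -primB; [|exact: cont_mul|exact: cont_mul].
  by congr prim; apply/funext => t; rewrite mulrBr.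
have ml : mass_l k (fun t => f t - g t) x = mass_l k f x - mass_l k g x by exact: P.
have mr : mass_r k (fun t => f t - g t) x = mass_r k f x - mass_r k g x.
  have aux (A B C D : R) : A - B - (C - D) = A - C - (B - D) by ring.
  by rewrite /mass_r (P _ x cr1) (P _ 1 cr1) aux.
rewrite /green ml mr.
move: (mass_l k f x) (mass_l k g x) (mass_r k f x) (mass_r k g x) (k / sinh k).
by move: (sinh_r k x) (sinh_l k x) => *; ring.
Qed.

(** Domination by the constant source m, whose masses are explicit. *)
Lemma green_masses k f m x : 0 < k -> continuous f ->
  (forall x, `|f x| <= m) -> 0 <= x <= 1 ->
  `|mass_l k f x| <= m / k * (cosh_l k x - 1) /\ `|mass_r k f x| <= m / k * (cosh_r k x - 1).
Proof.
move=> k0 cf fm x01; have /andP[x0 x1] := x01.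
have kn : k != 0 by rewrite gt_eqF.
have slb t : 0 <= t <= 1 -> 0 <= sinh_l k t.
  by move=> /andP[t0 _]; apply: sinh_ge0; rewrite mulr_ge0 // ltW.
have srb t : 0 <= t <= 1 -> 0 <= sinh_r k t.
  by move=> /andP[_ t1]; apply: sinh_ge0; rewrite mulr_ge0 ?(ltW k0) // subr_ge0.
have am (s : R -> R) : continuous s -> ac01 (prim (fun t => s t * f t)) (fun t => s t * f t).
  move=> cs; have c : continuous (fun t => s t * f t) by apply: cont_mul.
  by apply: ac01_C1; [move=> t t01; exact: is_derive_prim|exact: cont01_cont].
have al : ac01 (fun t => m / k * cosh_l k t) (fun t => m * sinh_l k t).
  apply: ac01_C1; last by apply: cont01_cont; apply: cont_mul; [exact: cst_continuous|exact: sinh_l_cont].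
  move=> t _; apply: (is_derive_eq (is_derive_funZ (m / k) (is_derive_cosh_l k t))).
  by field.
have ar : ac01 (fun t => - (m / k) * cosh_r k t) (fun t => m * sinh_r k t).
  apply: ac01_C1; last by apply: cont01_cont; apply: cont_mul; [exact: cst_continuous|exact: sinh_r_cont].
  move=> t _; apply: (is_derive_eq (is_derive_funZ (- (m / k)) (is_derive_cosh_r k t))).
  by field.
split.
  have := @ac01_dom _ _ _ _ _ 0 x (am _ (@sinh_l_cont k)) al _ (lexx 0) x0 x1.
  rewrite prim0 subr0 -mulrBr [cosh_l k 0]/cosh_l mulr0 cosh0. apply.
  move=> t t01; rewrite normrM (ger0_norm (slb t t01)) mulrC.
  by rewrite ler_wpM2r // slb.
have := @ac01_dom _ _ _ _ _ x 1 (am _ (@sinh_r_cont k)) ar _ x0 x1 (lexx 1).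
have -> : - (m / k) * cosh_r k 1 - - (m / k) * cosh_r k x = m / k * (cosh_r k x - 1).
  by rewrite [cosh_r k 1]/cosh_r subrr mulr0 cosh0; ring.
apply.
move=> t t01; rewrite normrM (ger0_norm (srb t t01)) mulrC.
by rewrite ler_wpM2r // srb.
Qed.

(** The Green operator has sup norm at most 1, whatever k is: this is the
    maximum principle, and it makes the fixed point problem uniform in eps. *)
Lemma green_bound k f m x : 0 < k -> continuous f -> (forall x, `|f x| <= m) ->
  0 <= x <= 1 -> `|green k f x| <= m.
Proof.
move=> k0 cf fm x01; have [ml mr] := green_masses k0 cf fm x01.
have m0 : 0 <= m by apply: le_trans (fm 0).
have s0 := sinh_gt0 k0; have /andP[x0 x1] := x01.
have sl0 : 0 <= sinh_l k x by apply: sinh_ge0; rewrite mulr_ge0 // ltW.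
have sr0 : 0 <= sinh_r k x by apply: sinh_ge0; rewrite mulr_ge0 ?subr_ge0 // ltW.
rewrite /green mulNr normrN normrM gtr0_norm ?divr_gt0 //.
apply: le_trans (_ : k / sinh k * (sinh_r k x * (m / k * (cosh_l k x - 1)) + sinh_l k x * (m / k * (cosh_r k x - 1))) <= _).
  rewrite ler_wpM2l ?(ltW (divr_gt0 k0 s0)) //.
  apply: le_trans (ler_normD _ _) _; rewrite (normrM (sinh_r k x)) (normrM (sinh_l k x)) (ger0_norm sl0) (ger0_norm sr0).
  by apply: lerD; rewrite ler_wpM2l.
have -> : k / sinh k * (sinh_r k x * (m / k * (cosh_l k x - 1)) + sinh_l k x * (m / k * (cosh_r k x - 1)))
   = m / sinh k * (sinh_r k x * cosh_l k x + cosh_r k x * sinh_l k x - (sinh_r k x + sinh_l k x)).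
  by field; rewrite !gt_eqF.
rewrite wronskian -[leRHS]mulr1 -mulrA ler_wpM2l //.
by rewrite mulrC ler_pdivrMr // mul1r; lra.
Qed.

Lemma dgreen_bound k f m x : 1 <= k -> continuous f -> (forall x, `|f x| <= m) ->
  0 <= x <= 1 -> `|dgreen k f x| <= 4 * k * m.
Proof.
move=> k1 cf fm x01; have k0 : 0 < k by apply: lt_le_trans k1.
have [ml mr] := green_masses k0 cf fm x01.
have m0 : 0 <= m by apply: le_trans (fm 0).
have s0 := sinh_gt0 k0; have /andP[x0 x1] := x01.
have sl0 : 0 <= sinh_l k x by apply: sinh_ge0; rewrite mulr_ge0 // ltW.
have sr0 : 0 <= sinh_r k x by apply: sinh_ge0; rewrite mulr_ge0 ?subr_ge0 // ltW.
have cl0 : 0 < cosh_l k x by exact: cosh_gt0.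
have cr0 : 0 < cosh_r k x by exact: cosh_gt0.
have cc : cosh_r k x * cosh_l k x <= cosh k.
  have -> : cosh k = cosh (k * (1 - x) + k * x) by rewrite -mulrDr subrK mulr1.
  by rewrite coshD lerDl mulr_ge0.
have c2 := cosh_le_2sinh k1.
rewrite /dgreen mulNr normrN normrM gtr0_norm ?divr_gt0 ?exprn_gt0 //.
apply: le_trans (_ : k ^+ 2 / sinh k * (cosh_l k x * (m / k * cosh_r k x) + cosh_r k x * (m / k * cosh_l k x)) <= _).
  rewrite ler_wpM2l ?divr_ge0 ?exprn_ge0 ?(ltW k0) ?(ltW s0) //.
  have mk : 0 <= m / k by rewrite divr_ge0 // ltW.
  apply: le_trans (ler_normB _ _) _; rewrite (normrM (cosh_l k x)) (normrM (cosh_r k x)) (gtr0_norm cl0) (gtr0_norm cr0).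
  have mr' : `|mass_r k f x| <= m / k * cosh_r k x.
    by apply: le_trans mr _; rewrite ler_wpM2l //; lra.
  have ml' : `|mass_l k f x| <= m / k * cosh_l k x.
    by apply: le_trans ml _; rewrite ler_wpM2l //; lra.
  by apply: lerD; rewrite ler_wpM2l // ltW.
have -> : k ^+ 2 / sinh k * (cosh_l k x * (m / k * cosh_r k x) + cosh_r k x * (m / k * cosh_l k x))
   = 2 * k * m * (cosh_r k x * cosh_l k x) / sinh k.
  by field; rewrite !gt_eqF.
rewrite ler_pdivrMr //.
have km : 0 <= 2 * k * m by rewrite !mulr_ge0 // ltW.
have -> : 4 * k * m * sinh k = 2 * k * m * (2 * sinh k) by ring.
by rewrite ler_wpM2l //; lra.
Qed.

End Green.

(** * A contraction principle for bounded continuous functions *)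

Section FixedPoint.
Context {R : realType}.
Implicit Types (p q : R -> R) (b d : R).

Definition cball b p := continuous p /\ forall x, `|p x| <= b.

(** Picard iteration from 0. The iterates satisfy |y n - y m| <= 2 c n for
    n <= m, with c n = b / 2^n, so the limit can be taken pointwise as the
    supremum of the lower bounds y n x - 2 c n. *)
Lemma contraction_fixed_point (S : (R -> R) -> R -> R) b :
  (forall p, cball b p -> cball b (S p)) ->
  (forall p q d, cball b p -> cball b q -> (forall x, `|p x - q x| <= d) ->
     forall x, `|S p x - S q x| <= d / 2) ->
  0 <= b ->
  exists2 p, cball b p & forall x, S p x = p x.
Proof.
move=> SB SC b0.
pose y n : R -> R := iter n S (fun=> 0).
have yB n : cball b (y n).
  elim: n => [|n IH]; last exact: SB.
  by split; [exact: cst_continuous|move=> x; rewrite normr0].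
pose c n : R := b / 2 ^+ n.
have c0 n : 0 <= c n by rewrite divr_ge0 // exprn_ge0.
have cS n : c n = c n.+1 + c n.+1.
  by rewrite /c exprS; field; rewrite expf_neq0.
have ystep n x : `|y n x - y n.+1 x| <= c n.
  elim: n x => [|n IH] x.
    by rewrite /c expr0 divr1 sub0r normrN; exact: (yB 1%N).2.
  have := SC _ _ _ (yB n) (yB n.+1) IH x.
  by have := cS n; lra.
have ydist n k x : `|y n x - y (n + k)%N x| <= 2 * c n - 2 * c (n + k)%N.
  elim: k => [|k IH]; first by rewrite addn0 !subrr normr0.
  rewrite addnS; apply: le_trans (ler_distD (y (n + k)%N x) _ _) _.
  have := ystep (n + k)%N x; have := cS (n + k)%N; have := IH; lra.
have ccvg (e : R) : 0 < e -> exists n, c n + c n < e.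
  move=> e0.
  have : geometric b (2^-1 : R) n @[n --> \oo] --> (0 : R).
    by apply: cvg_geometric; rewrite gtr0_norm ?invr_gt0 // invf_lt1 // ltr1n.
  move/cvgrPdist_lt => /(_ (e / 2)); rewrite divr_gt0 // => /(_ isT) [n _ /(_ n (leqnn n))].
  rewrite /= sub0r normrN => H; exists n.
  have : c n < e / 2.
    by rewrite /c -exprVn; apply: le_lt_trans H; exact: ler_norm.
  lra.
have sandwich n m x : y n x - 2 * c n <= y m x + 2 * c m.
  have [nm|mn] := leqP n m.
    have := ydist n (m - n)%N x; rewrite subnKC // ler_norml => /andP[? ?].
    by have := c0 m; lra.
  have := ydist m (n - m)%N x; rewrite subnKC 1?ltnW // ler_norml => /andP[? ?].
  by have := c0 n; lra.
pose p x := sup (range (fun n => y n x - 2 * c n)).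
have yp n x : `|y n x - p x| <= 2 * c n.
  have hs : has_sup (range (fun n => y n x - 2 * c n)).
    split; first by exists (y 0%N x - 2 * c 0%N), 0%N.
    by exists (y n x + 2 * c n) => _ [k _ <-].
  have h1 : y n x - 2 * c n <= p x by apply: sup_upper_bound => //; exists n.
  have h2 : p x <= y n x + 2 * c n.
    by apply: ge_sup; [exact: hs.1|move=> _ [k _ <-]].
  by rewrite ler_norml; apply/andP; split; lra.
have pB : cball b p.
  split.
    move=> x; apply/cvgrPdist_lt => e e0.
    have [n cn] := ccvg (e / 6) (divr_gt0 e0 (ltr0n R 6)).
    have := (yB n).1 x => /cvgrPdist_lt /(_ (e / 3)); rewrite divr_gt0 // => /(_ isT).
    apply: filterS => z yz.
    have -> : p x - p z = (p x - y n x) + (y n x - y n z) + (y n z - p z) by ring.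
    apply: le_lt_trans (ler_normD _ _) _.
    have := yp n z; have := yp n x; rewrite distrC => h1 h2.
    have := ler_normD (p x - y n x) (y n x - y n z); lra.
  move=> x; apply/ler_addgt0Pr => e e0.
  have [n cn] := ccvg (e / 2) (divr_gt0 e0 (ltr0n R 2)).
  have := yp n x; rewrite distrC => h1; have := (yB n).2 x.
  have := ler_normD (p x - y n x) (y n x); rewrite subrK; lra.
exists p => // x; apply/eqP; rewrite -subr_eq0 -normr_le0.
apply/ler_addgt0Pr => e e0; rewrite add0r.
have [n cn] := ccvg (e / 2) (divr_gt0 e0 (ltr0n R 2)).
have h1 := SC _ _ _ (yB n) pB (yp n) x.
have h2 := yp n.+1 x; have := cS n; have := c0 n.+1 => ? ?.
have -> : S p x - p x = (S p x - S (y n) x) + (y n.+1 x - p x) by rewrite addrA subrK.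
apply: le_trans (ler_normD _ _) _; rewrite distrC; lra.
Qed.
End FixedPoint.

(** * Lipschitz estimates for the reduced radial equation *)

Section Lip.
Context {R : realType}.
Notation mu := (@lebesgue_measure R).
Implicit Types (K d x y m : R).

(** Two values x and y of the same quantity, at configurations at distance d, with
    one constant K for the size and the Lipschitz estimate. Such constants can be
    propagated through products and quotients. *)
Definition bounded_lip K d x y := [/\ `|x| <= K, `|y| <= K & `|x - y| <= K * d].

Lemma bounded_lip_ge0 K d x y : bounded_lip K d x y -> 0 <= K.
Proof. by case=> h _ _; apply: le_trans h. Qed.

Lemma bounded_lip_cst c d : 0 <= d -> bounded_lip `|c| d c c.
Proof. by move=> d0; split; rewrite ?subrr ?normr0 ?mulr_ge0. Qed.

Lemma bounded_lip_le K K' d x y : 0 <= d -> K <= K' -> bounded_lip K d x y -> bounded_lip K' d x y.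
Proof.
move=> d0 KK [h1 h2 h3]; split; [exact: le_trans h1 KK|exact: le_trans h2 KK|].
by apply: le_trans h3 _; rewrite ler_wpM2r.
Qed.

Lemma bounded_lipD K d x y K' x' y' : bounded_lip K d x y -> bounded_lip K' d x' y' ->
  bounded_lip (K + K') d (x + x') (y + y').
Proof.
move=> [h1 h2 h3] [g1 g2 g3]; split.
- by apply: le_trans (ler_normD _ _) _; exact: lerD.
- by apply: le_trans (ler_normD _ _) _; exact: lerD.
- rewrite opprD addrACA mulrDl; apply: le_trans (ler_normD _ _) _; exact: lerD.
Qed.

Lemma bounded_lipN K d x y : bounded_lip K d x y -> bounded_lip K d (- x) (- y).
Proof. by case=> h1 h2 h3; split; rewrite ?normrN // -opprD normrN. Qed.

Lemma bounded_lipM K d x y K' x' y' : bounded_lip K d x y -> bounded_lip K' d x' y' -> 0 <= d ->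
  bounded_lip (2 * (K * K')) d (x * x') (y * y').
Proof.
move=> l l' d0; have K0 := bounded_lip_ge0 l; have K0' := bounded_lip_ge0 l'.
have KK : 0 <= K * K' by exact: mulr_ge0.
case: l l' => [h1 h2 h3] [g1 g2 g3].
have b u v : `|u| <= K -> `|v| <= K' -> `|u * v| <= 2 * (K * K').
  move=> hu hv; rewrite normrM; apply: le_trans (_ : K * K' <= _); last by lra.
  exact: ler_pM.
split; [exact: b|exact: b|].
have -> : x * x' - y * y' = (x - y) * x' + y * (x' - y') by ring.
apply: le_trans (ler_normD _ _) _; rewrite !normrM.
have : `|x - y| * `|x'| <= (K * d) * K' by apply: ler_pM.
have : `|y| * `|x' - y'| <= K * (K' * d) by apply: ler_pM.
lra.
Qed.

Lemma bounded_lipV K m d x y : 0 < m -> m <= x -> m <= y -> 0 <= d -> bounded_lip K d x y ->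
  bounded_lip (m^-1 + K / m ^+ 2) d x^-1 y^-1.
Proof.
move=> m0 mx my d0 l; have K0 := bounded_lip_ge0 l; case: l => [h1 h2 h3].
have x0 := lt_le_trans m0 mx; have y0 := lt_le_trans m0 my.
have Km : 0 <= K / m ^+ 2 by rewrite divr_ge0 // exprn_ge0 // ltW.
have b u : m <= u -> `|u^-1| <= m^-1 + K / m ^+ 2.
  move=> mu; have u0 := lt_le_trans m0 mu.
  by rewrite gtr0_norm ?invr_gt0 //; apply: ler_wpDr => //; rewrite lef_pV2.
split; [exact: b|exact: b|].
have -> : x^-1 - y^-1 = - ((x - y) / (x * y)) by field; rewrite !gt_eqF.
rewrite normrN normrM normfV (gtr0_norm (mulr_gt0 x0 y0)).
rewrite ler_pdivrMr ?mulr_gt0 //; apply: le_trans h3 _.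
apply: le_trans (_ : (K / m ^+ 2 * d) * m ^+ 2 <= _).
  by rewrite mulrAC divfK // gt_eqF // exprn_gt0.
have m1 : 0 <= m^-1 by rewrite invr_ge0 ltW.
apply: ler_pM.
- exact: mulr_ge0.
- by rewrite exprn_ge0 // ltW.
- by apply: ler_wpM2r => //; rewrite lerDr.
- by rewrite expr2; apply: ler_pM => //; exact: ltW.
Qed.

Lemma bounded_lip_int K d (f g : R -> R) : continuous f -> continuous g ->
  (forall x, bounded_lip K d (f x) (g x)) ->
  bounded_lip K d (\int[mu]_(x in `[0, 1]) f x) (\int[mu]_(x in `[0, 1]) g x).
Proof.
move=> cf cg l.
have b (u : R -> R) c : continuous u -> (forall x, `|u x| <= c) ->
    `|\int[mu]_(x in `[0, 1]) u x| <= c.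
  move=> cu uc; have iu := intg01_cont (cont01_cont cu).
  apply: le_trans (le_normr_Rintegral _ _) _ => //.
  rewrite -[leRHS]int01_cst; apply: le_Rintegral => //.
  - exact: (intg01_norm iu).
  - exact: intg01_cst.
split; [by apply: b => // x; case: (l x)|by apply: b => // x; case: (l x)|].
rewrite -RintegralB //; [|exact: (intg01_cont (cont01_cont cf))|exact: (intg01_cont (cont01_cont cg))].
apply: b => [x|x]; last by case: (l x).
by apply: cvgB; [exact: cf|exact: cg].
Qed.

End Lip.

Section Nonlinearity.
Context {R : realType}.
Notation mu := (@lebesgue_measure R).
Context (L a beta : R) (L0 : 0 < L).
Implicit Types (e : R) (p q : R -> R).

(** Solving angular_momentum = C for w gives w = C * wslope + wshift. *)
Definition wslope e rho : R := (e * (rho * rho) + L * ((rho * rho) * (rho * rho)))^-1.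
Definition wshift e rho : R := a * L * (e + L * (rho * rho))^-1.

(** The value of C for which the total angle, the integral of w, is beta. *)
Definition wconst e p : R :=
  (beta - \int[mu]_(x in `[0, 1]) wshift e (1 + p x))
  * (\int[mu]_(x in `[0, 1]) wslope e (1 + p x))^-1.

Definition velocity e p x : R :=
  wconst e p * wslope e (1 + p x) + wshift e (1 + p x).

(** The part of the radial force that stays bounded as e tends to 0. *)
Definition reaction e p x : R :=
  let rho := 1 + p x in let w := velocity e p x in
  e * rho * (w * w) + 2 * L * rho * (w * (rho * rho * w - a)).

Lemma wden_bounds e r : 0 < e -> e <= 1 -> `|r| <= 20^-1 ->
  let rho := 1 + r in
  [/\ L / 2 <= e * (rho * rho) + L * ((rho * rho) * (rho * rho)),
      e * (rho * rho) + L * ((rho * rho) * (rho * rho)) <= 2 + 2 * L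
    & L / 2 <= e + L * (rho * rho)].
Proof.
move=> e0 e1; rewrite ler_norml => /andP[rl ru] rho.
have [h1 h2] : 361 / 400 <= rho * rho /\ rho * rho <= 441 / 400.
  by rewrite /rho; split; nra.
have [h3 h4] : 1 / 2 <= (rho * rho) * (rho * rho) /\ (rho * rho) * (rho * rho) <= 2.
  by move: (rho * rho) h1 h2 => z h1 h2; split; nra.
move: (rho * rho) (rho * rho * (rho * rho)) h1 h2 h3 h4 => z z4 h1 h2 h3 h4.
have z0 : 0 <= z by lra.
have ez0 := mulr_ge0 (ltW e0) z0.
have ez := ler_wpM2r z0 e1.
have Lz4 := ler_wpM2l (ltW L0) h3.
have Lz4' := ler_wpM2l (ltW L0) h4.
have Lz := ler_wpM2l (ltW L0) h1.
by split; lra.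
Qed.

Lemma half_L_gt0 : 0 < L / 2. Proof. by rewrite divr_gt0. Qed.

Lemma wslope_cont e p : 0 < e -> e <= 1 -> cball 20^-1 p ->
  continuous (fun x => wslope e (1 + p x)).
Proof.
move=> e0 e1 [cp pb] x.
have [h _ _] := wden_bounds e0 e1 (pb x).
have cr : (1 + p t) @[t --> x] --> 1 + p x by apply: cvgD; [exact: cvg_cst|exact: cp].
apply: cvgV; first by rewrite gt_eqF // (lt_le_trans half_L_gt0).
by apply: cvgD; (apply: cvgM; [exact: cvg_cst|]); repeat apply: cvgM.
Qed.

Lemma wshift_cont e p : 0 < e -> e <= 1 -> cball 20^-1 p ->
  continuous (fun x => wshift e (1 + p x)).
Proof.
move=> e0 e1 [cp pb] x.
have [_ _ h] := wden_bounds e0 e1 (pb x).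
have cr : (1 + p t) @[t --> x] --> 1 + p x by apply: cvgD; [exact: cvg_cst|exact: cp].
apply: cvgM; first exact: cvg_cst.
apply: cvgV; first by rewrite gt_eqF // (lt_le_trans half_L_gt0).
by apply: cvgD; [exact: cvg_cst|apply: cvgM; [exact: cvg_cst|exact: cvgM]].
Qed.

Lemma velocity_cont e p : 0 < e -> e <= 1 -> cball 20^-1 p ->
  continuous (velocity e p).
Proof.
move=> e0 e1 pB x; apply: cvgD; last exact: (wshift_cont e0 e1 pB).
by apply: cvgM; [exact: cvg_cst|exact: (wslope_cont e0 e1 pB)].
Qed.

Lemma reaction_cont e p : 0 < e -> e <= 1 -> cball 20^-1 p ->
  continuous (reaction e p).
Proof.
move=> e0 e1 pB x; have cw := velocity_cont e0 e1 pB (x := x).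
have cr : (1 + p t) @[t --> x] --> 1 + p x.
  by apply: cvgD; [exact: cvg_cst|exact: pB.1].
apply: cvgD.
  by apply: cvgM; [apply: cvgM; [exact: cvg_cst|]|apply: cvgM].
apply: cvgM; first by apply: cvgM; [exact: cvg_cst|].
apply: cvgM => //; apply: cvgB; last exact: cvg_cst.
by apply: cvgM => //; apply: cvgM.
Qed.

(** Keeps the denominator of wconst away from 0. *)
Lemma int_wslope_ge e p : 0 < e -> e <= 1 -> cball 20^-1 p ->
  (2 + 2 * L)^-1 <= \int[mu]_(x in `[0, 1]) wslope e (1 + p x).
Proof.
move=> e0 e1 pB; rewrite -[leLHS]int01_cst; apply: le_Rintegral => //.
- exact: intg01_cst.
- exact: (intg01_cont (cont01_cont (wslope_cont e0 e1 pB))).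
move=> x _; have [h1 h2 _] := wden_bounds e0 e1 (pB.2 x).
have den0 := lt_le_trans half_L_gt0 h1.
by rewrite lef_pV2 // posrE; lra.
Qed.

Lemma lip_pointwise : exists K, forall e r s d, 0 < e -> e <= 1 ->
  `|r| <= 20^-1 -> `|s| <= 20^-1 -> `|r - s| <= d ->
  [/\ bounded_lip K d (1 + r) (1 + s), bounded_lip K d (wslope e (1 + r)) (wslope e (1 + s))
    & bounded_lip K d (wshift e (1 + r)) (wshift e (1 + s))].
Proof.
(* K1 and K2 are the constants that the product and quotient rules return *)
pose K1 := (L / 2)^-1 + (2 * (1 * (2 * (2 * 2))) +
   2 * (`|L| * (2 * (2 * (2 * 2) * (2 * (2 * 2)))))) / (L / 2) ^+ 2.
pose K2 := 2 * (`|a * L| * ((L / 2)^-1 + (1 + 2 * (`|L| * (2 * (2 * 2)))) / (L / 2) ^+ 2)).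
exists (2 + `|K1| + `|K2|) => e r s d e0 e1 rb sb rs.
have d0 : 0 <= d by apply: le_trans rs.
have lr : bounded_lip 2 d (1 + r) (1 + s).
  move: rb sb; rewrite !ler_norml => /andP[? ?] /andP[? ?].
  split; [by rewrite ler_norml; lra|by rewrite ler_norml; lra|].
  by rewrite opprD addrACA subrr add0r; lra.
have lr2 := bounded_lipM lr lr d0.
have lr4 := bounded_lipM lr2 lr2 d0.
have le : bounded_lip 1 d e e by split; [rewrite gtr0_norm|rewrite gtr0_norm|rewrite subrr normr0 mul1r].
have lL := bounded_lip_cst L d0.
have lden := bounded_lipD (bounded_lipM le lr2 d0) (bounded_lipM lL lr4 d0).
have lden2 := bounded_lipD le (bounded_lipM lL lr2 d0).
have [r1 _ r2] := wden_bounds e0 e1 rb; have [s1 _ s2] := wden_bounds e0 e1 sb.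
have ls := bounded_lipV half_L_gt0 r1 s1 d0 lden.
have lh := bounded_lipM (bounded_lip_cst (a * L) d0) (bounded_lipV half_L_gt0 r2 s2 d0 lden2) d0.
have k1 := ler_norm K1; have k2 := ler_norm K2.
have k1' := normr_ge0 K1; have k2' := normr_ge0 K2.
split.
- by apply: bounded_lip_le lr => //; lra.
- by apply: bounded_lip_le ls => //; rewrite -/K1; lra.
- by apply: bounded_lip_le lh => //; rewrite -/K2; lra.
Qed.

Lemma lip_velocity : exists K, forall e p q d, 0 < e -> e <= 1 ->
  cball 20^-1 p -> cball 20^-1 q -> (forall x, `|p x - q x| <= d) ->
  forall x, bounded_lip K d (velocity e p x) (velocity e q x).
Proof.
have m0 : 0 < (2 + 2 * L)^-1 by rewrite invr_gt0; have := L0; lra.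
have [K1 H1] := lip_pointwise; eexists => e p q d e0 e1 pB qB pq x.
have d0 : 0 <= d by apply: le_trans (pq 0).
have H y := H1 e _ _ d e0 e1 (pB.2 y) (qB.2 y) (pq y).
have li1 := bounded_lip_int (wshift_cont e0 e1 pB) (wshift_cont e0 e1 qB)
  (fun y => let: And3 _ _ h := H y in h).
have li2 := bounded_lip_int (wslope_cont e0 e1 pB) (wslope_cont e0 e1 qB)
  (fun y => let: And3 _ h _ := H y in h).
have lc := bounded_lipM (bounded_lipD (bounded_lip_cst beta d0) (bounded_lipN li1))
  (bounded_lipV m0 (int_wslope_ge e0 e1 pB) (int_wslope_ge e0 e1 qB) d0 li2) d0.
have [_ hs hh] := H x.
exact: (bounded_lipD (bounded_lipM lc hs d0) hh).
Qed.

Lemma lip_velocity_reaction : exists2 K, 1 <= K & forall e p q d, 0 < e -> e <= 1 ->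
  cball 20^-1 p -> cball 20^-1 q -> (forall x, `|p x - q x| <= d) ->
  forall x, bounded_lip K d (velocity e p x) (velocity e q x) /\
            bounded_lip K d (reaction e p x) (reaction e q x).
Proof.
have [K1 H1] := lip_pointwise; have [K2 H2] := lip_velocity.
have [K3 H3] : exists K, forall e p q d, 0 < e -> e <= 1 ->
  cball 20^-1 p -> cball 20^-1 q -> (forall x, `|p x - q x| <= d) ->
  forall x, bounded_lip K d (reaction e p x) (reaction e q x).
  eexists => e p q d e0 e1 pB qB pq x.
  have d0 : 0 <= d by apply: le_trans (pq 0).
  have lw := H2 e p q d e0 e1 pB qB pq x.
  have [lr _ _] := H1 e _ _ d e0 e1 (pB.2 x) (qB.2 x) (pq x).
  have le : bounded_lip 1 d e e by split; [rewrite gtr0_norm|rewrite gtr0_norm|rewrite subrr normr0 mul1r].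
  have l2L := bounded_lip_cst (2 * L) d0.
  exact: (bounded_lipD (bounded_lipM (bounded_lipM le lr d0) (bounded_lipM lw lw d0) d0)
    (bounded_lipM (bounded_lipM l2L lr d0)
      (bounded_lipM lw (bounded_lipD (bounded_lipM (bounded_lipM lr lr d0) lw d0) (bounded_lipN (bounded_lip_cst a d0))) d0) d0)).
have k2 := ler_norm K2; have k3 := ler_norm K3.
have k2' := normr_ge0 K2; have k3' := normr_ge0 K3.
exists (1 + `|K2| + `|K3|); first by lra.
move=> e p q d e0 e1 pB qB pq x.
have d0 : 0 <= d by apply: le_trans (pq 0).
split.
- by apply: bounded_lip_le (H2 e p q d e0 e1 pB qB pq x) => //; lra.
- by apply: bounded_lip_le (H3 e p q d e0 e1 pB qB pq x) => //; lra.
Qed.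

Lemma velocity_const e x : 0 < e -> e <= 1 -> velocity e (fun=> 0) x = beta.
Proof.
move=> e0 e1; rewrite /velocity /wconst !int01_cst.
have z0 : `|0 : R| <= 20^-1 by rewrite normr0 invr_ge0.
have [h _ _] := wden_bounds e0 e1 z0.
rewrite divfK ?subrK // /wslope invr_eq0 gt_eqF //.
exact: lt_le_trans half_L_gt0 h.
Qed.

Lemma int_velocity e p : 0 < e -> e <= 1 -> cball 20^-1 p ->
  \int[mu]_(x in `[0, 1]) velocity e p x = beta.
Proof.
move=> e0 e1 pB; have cs := intg01_cont (cont01_cont (wslope_cont e0 e1 pB)).
have ch := intg01_cont (cont01_cont (wshift_cont e0 e1 pB)).
rewrite RintegralD //; last exact: intg01Z.
rewrite RintegralZl // divfK ?subrK //.
rewrite gt_eqF //; apply: lt_le_trans (int_wslope_ge e0 e1 pB).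
by rewrite invr_gt0; have := L0; lra.
Qed.

Lemma angular_momentum_velocity e p x : 0 < e -> e <= 1 -> `|p x| <= 20^-1 ->
  angular_momentum L a e (1 + p x) (velocity e p x) = wconst e p.
Proof.
move=> e0 e1 pb; have [h1 _ h2] := wden_bounds e0 e1 pb.
rewrite /angular_momentum /velocity /wslope /wshift.
have d1 := lt_le_trans half_L_gt0 h1; have d2 := lt_le_trans half_L_gt0 h2.
move: pb; rewrite ler_norml => /andP[pl _].
have : 1 + p x != 0 by rewrite gt_eqF //; lra.
move: (1 + p x) d1 d2 (wconst e p) => r d1 d2 C r0.
have E : e * (r * r) + L * (r * r * (r * r)) = (r * r) * (e + L * (r * r)) by ring.
rewrite E; field.
by rewrite r0 gt_eqF.
Qed.

End Nonlinearity.

(** * Solutions of the Euler-Lagrange equations *)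

Section ELSolution.
Context {R : realType}.
Context (L a beta : R) (L0 : 0 < L).

(** With r = 1 + p, the equation e r'' = radial_force is equivalent to
    p'' = (2 / e^2) (p + source), where source collects the quadratic and cubic
    terms of the potential and the bounded reaction. *)
Definition source (e : R) (p : R -> R) x : R :=
  2^-1 * (3 * (p x * p x) + p x * (p x * p x) + e * reaction L a beta e p x).

Lemma source_cont e p : 0 < e -> e <= 1 -> cball 20^-1 p -> continuous (source e p).
Proof.
move=> e0 e1 pB x; have cp : p t @[t --> x] --> p x by exact: pB.1.
apply: cvgM; first exact: cvg_cst.
apply: cvgD; last first.
  by apply: cvgM; [exact: cvg_cst|exact: (reaction_cont L0 e0 e1 pB)].
by apply: cvgD; [apply: cvgM; [exact: cvg_cst|]|apply: cvgM => //]; exact: cvgM.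
Qed.

(** Critical points of the energy with total angle beta, in polar form, together with
    the estimates that determine their limit. *)
Record EL_data (e K : R) (r r1 r2 th w : R -> R) (C : R) : Prop := {
  EL_dr : forall x : R, 0 <= x <= 1 -> is_derive x (1 : R) r (r1 x);
  EL_dr1 : forall x : R, 0 <= x <= 1 -> is_derive x (1 : R) r1 (r2 x);
  EL_dth : forall x : R, 0 <= x <= 1 -> is_derive x (1 : R) th (w x);
  EL_r2_cont : cont01 r2;
  EL_w_cont : cont01 w;
  EL_r : forall x, 0 <= x <= 1 -> `|r x - 1| <= K * e;
  EL_r1 : forall x, 0 <= x <= 1 -> `|r1 x| <= K;
  EL_w : forall x, 0 <= x <= 1 -> `|w x - beta| <= K * e;
  EL_radial : forall x, 0 <= x <= 1 -> e * r2 x = radial_force L a e (r x) (w x);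
  EL_angular : forall x, 0 <= x <= 1 -> angular_momentum L a e (r x) (w x) = C;
  EL_r_0 : r 0 = 1;
  EL_r_1 : r 1 = 1;
  EL_th_0 : th 0 = 0;
  EL_th_1 : th 1 = beta }.

(** Fixed point of p |-> green (source p) on the ball of radius b = K e. There
    source is bounded by b and is Lipschitz with constant 1/2, because its
    polynomial part is at least quadratic and the reaction carries a factor e;
    the Green operator preserves both bounds. The velocity of p = 0 is the
    constant beta, so the Lipschitz estimate also gives w - beta = O(e). *)
Lemma EL_solution : exists K e1, [/\ 1 <= K, 0 < e1, e1 <= 1 &
  forall e, 0 < e < e1 -> exists r r1 r2 th w C, EL_data e K r r1 r2 th w C].
Proof.
have [K K1 HK] := lip_velocity_reaction a beta L0.
have K0 : 0 < K by lra.
exists (8 * K + K ^+ 2), (20 * K)^-1; split.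
- have := sqr_ge0 K; lra.
- by rewrite invr_gt0 mulr_gt0.
- by rewrite invf_le1 ?mulr_gt0 //; lra.
move=> e /andP[e0]; rewrite -[X in _ < X]mul1r ltr_pdivlMr ?mulr_gt0 // => eK.
have [b bE] : exists b, b = K * e by exists (K * e).
have b0 : 0 <= b by rewrite bE mulr_ge0 // ltW.
have b20 : b <= 20^-1 by rewrite bE; lra.
have e1 : e <= 1 by nra.
pose k := Num.sqrt 2 / e.
have s2 : Num.sqrt 2 ^+ 2 = 2 :> R by rewrite sqr_sqrtr.
have s0 : 1 <= Num.sqrt 2 :> R by rewrite -[X in X <= _]sqrtr1 ler_sqrt // ler1n.
have s22 : Num.sqrt 2 <= 2 :> R by nra.
have k2 : k ^+ 2 = 2 / e ^+ 2 by rewrite /k expr_div_n s2.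
have k1 : 1 <= k by rewrite /k ler_pdivlMr // mul1r; lra.
have k0 : 0 < k by lra.
have B20 p : cball b p -> cball 20^-1 p.
  by move=> [cp pb]; split => // x; exact: le_trans (pb x) b20.
have zB : cball b (fun=> 0 : R).
  by split; [exact: cst_continuous|move=> x; rewrite normr0].
pose S p x := green k (source e p) (clamp x).
have sB p : cball b p -> forall x, `|source e p x| <= b.
  move=> pB x; have [cp pb] := pB.
  have [_ [g _ _]] := HK e p p 0 e0 e1 (B20 p pB) (B20 p pB)
    (fun y => eq_ind_r (fun z => z <= 0) (lexx 0) (etrans (congr1 Num.norm (subrr (p y))) (normr0 _))) x.
  move: g (pb x); rewrite /source; move: (reaction _ _ _ _ _ _) (p x) => g z.
  rewrite !ler_norml => /andP[g1 g2] /andP[z1 z2].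
  have eg : - b <= e * g <= b by rewrite bE; apply/andP; split; nra.
  have zz : 0 <= z * z <= b * b by apply/andP; split; nra.
  have zb : b * b <= b * 20^-1 by rewrite ler_wpM2l.
  move: eg zz => /andP[? ?] /andP[? ?].
  have zzz : - (b * b) <= z * (z * z) <= b * b.
    have : -1 <= z <= 1 by lra.
    by move=> /andP[? ?]; apply/andP; split; nra.
  move: zzz => /andP[? ?]; apply/andP; split; lra.
have sC p := source_cont e0 e1 (p := p).
have SB p : cball b p -> cball b (S p).
  move=> pB; have cs := sC p (B20 p pB); split.
    apply: (@comp_clamp_cont R (green k (source e p))).
    apply: cont01_pt => x x01.
    by have /is_derive_cont := is_derive_green k cs x01.
  by move=> x; apply: green_bound => //; [exact: sB|exact: clamp01].
have SC p q d : cball b p -> cball b q -> (forall x, `|p x - q x| <= d) ->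
    forall x, `|S p x - S q x| <= d / 2.
  move=> pB qB pq x.
  rewrite /S -greenB; [|exact: sC (B20 p pB)|exact: sC (B20 q qB)].
  apply: green_bound => //; last exact: clamp01.
    by move=> y; apply: cvgB; [exact: (sC p (B20 p pB))|exact: (sC q (B20 q qB))].
  move=> y; have [_ [_ _ g]] := HK e p q d e0 e1 (B20 p pB) (B20 q qB) pq y.
  have d0 : 0 <= d by apply: le_trans (pq 0).
  move: g (pB.2 y) (qB.2 y) (pq y); rewrite /source.
  move: (reaction _ _ _ _ p _) (reaction _ _ _ _ q _) (p y) (q y) => g h z t gh zb tb zt.
  have -> : 2^-1 * (3 * (z * z) + z * (z * z) + e * g) - 2^-1 * (3 * (t * t) + t * (t * t) + e * h)
    = 2^-1 * ((z - t) * (3 * (z + t) + (z * z + z * t + t * t)) + e * (g - h)) by ring.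
  rewrite normrM gtr0_norm ?invr_gt0 // mulrC ler_wpM2r ?invr_ge0 //.
  apply: le_trans (ler_normD _ _) _; rewrite !normrM (gtr0_norm e0).
  have h1 : e * `|g - h| <= b * d.
    by rewrite bE; apply: le_trans (ler_wpM2l (ltW e0) gh) _; lra.
  have h2 : `|3 * (z + t) + (z * z + z * t + t * t)| <= 7 / 20.
    move: zb tb; rewrite !ler_norml => /andP[? ?] /andP[? ?].
    have zl : - (20^-1) <= z <= 20^-1 by lra.
    have tl : - (20^-1) <= t <= 20^-1 by lra.
    move: zl tl => /andP[? ?] /andP[? ?].
    by apply/andP; split; nra.
  have h3 : `|z - t| * `|3 * (z + t) + (z * z + z * t + t * t)| <= d * (7 / 20).
    by apply: ler_pM.
  have h4 : b * d <= 20^-1 * d by rewrite ler_wpM2r.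
  lra.
have [p pB Sp] := contraction_fixed_point SB SC b0.
have pB20 := B20 p pB; have cs := sC p pB20.
have py x : 0 <= x <= 1 -> p x = green k (source e p) x.
  by move=> x01; rewrite -Sp /S clamp_id.
pose w := velocity L a beta e p.
have cw : continuous w by exact: velocity_cont.
have e_n0 : e != 0 by rewrite gt_eqF.
exists (fun x => 1 + green k (source e p) x), (dgreen k (source e p)),
  (fun x => k ^+ 2 * (green k (source e p) x + source e p x)), (prim w), w,
  (wconst L a beta e p).
have dg (x : R) : 0 <= x <= 1 -> is_derive x (1 : R) (green k (source e p)) (dgreen k (source e p) x).
  by move=> x01; exact: is_derive_green.
split.
- move=> x x01; have := is_derive_funD (is_derive_cst (1 : R) x (1 : R)) (dg x x01).
  by rewrite add0r.
- by move=> x x01; exact: is_derive_dgreen.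
- by move=> x x01; exact: is_derive_prim.
- apply: cont01M; first exact: cont01_cst.
  apply: cont01D; last exact: cont01_cont.
  by apply: cont01_pt => x /dg /is_derive_cont.
- exact: cont01_cont.
- move=> x x01; rewrite addrAC subrr add0r -py //.
  apply: le_trans (pB.2 x) _; rewrite bE; have := sqr_ge0 K; nra.
- move=> x x01; have := dgreen_bound k1 cs (sB p pB) x01.
  have -> : 4 * k * b = 4 * Num.sqrt 2 * K by rewrite /k bE; field.
  move=> H; apply: le_trans H _; have := sqr_ge0 K; nra.
- move=> x x01.
  have pz y : `|p y - (fun=> 0) y| <= b by rewrite subr0; exact: pB.2.
  have [[_ _ h] _] := HK e p _ b e0 e1 pB20 (B20 _ zB) pz x.
  move: h; rewrite velocity_const // => h; apply: le_trans h _.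
  by rewrite bE; nra.
- move=> x x01; have [h1 _ h2] := wden_bounds L0 e0 e1 (pB20.2 x).
  rewrite k2 -py // /source /reaction /radial_force -/(w x).
  by field.
- move=> x x01; rewrite -py //; apply: angular_momentum_velocity => //; exact: pB20.2.
- by rewrite green0 addr0.
- by rewrite green1 addr0.
- exact: prim0.
- have aw : ac01 (prim w) w.
    by apply: ac01_C1; [move=> x x01; exact: is_derive_prim|exact: cont01_cont].
  have := ac01_int aw; rewrite prim0 subr0 => <-.
  exact: int_velocity.
Qed.

End ELSolution.

(** * Limits as eps tends to 0 *)

Section Limits.
Context {R : realType}.

Lemma Linfty_norm_01_le (f : R -> R) (c : R) : 0 <= c ->
  (forall x, 0 <= x <= 1 -> `|f x| <= c) -> (Linfty_norm_01 f <= c%:E)%E.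
Proof.
move=> c0 fc; rewrite /Linfty_norm_01 unlock /=.
case: ifP => _; last by rewrite lee_fin.
apply/ess_supP; apply: nearW => x /=.
rewrite /= lee_fin patchE; case: ifPn; last by rewrite normr0.
by rewrite inE /= in_itv /= => /andP[x0 x1]; apply: fc; rewrite !ltW.
Qed.

Lemma uniform_rate (f : R -> R -> R) (g : R -> R) (K e0 : R) : 0 < e0 ->
  (forall e x, 0 < e < e0 -> 0 <= x <= 1 -> `|f e x - g x| <= K * e) ->
  {uniform `[0, 1], f e @[e --> 0^'+] --> g}.
Proof.
move=> e0_gt0 H P /uniform_nbhs [E [entE EP]].
move: entE; rewrite -entourage_ballE => -[d /= d0 dE].
have K1 : 0 < 1 + `|K| by rewrite ltr_pwDl.
near=> e; apply: EP => x; rewrite /= in_itv /= => x01; apply: dE.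
rewrite /= -ball_normE /= distrC.
have e_pos : 0 < e by near: e; exact: nbhs_right_gt.
have e_lt : e < e0 by near: e; exact: nbhs_right_lt.
apply: le_lt_trans (H e x _ x01) _; first by rewrite e_pos.
apply: le_lt_trans (_ : (1 + `|K|) * e < d).
  by rewrite ler_wpM2r ?(ltW e_pos) //; have := ler_norm K; lra.
rewrite mulrC -ltr_pdivlMr //.
by near: e; apply: nbhs_right_lt; rewrite divr_gt0.
Unshelve. all: by end_near. Qed.

Lemma cvg_rate (f : R -> R) (l K e0 : R) : 0 < e0 ->
  (forall e, 0 < e < e0 -> `|f e - l| <= K * e) -> f e @[e --> 0^'+] --> l.
Proof.
move=> e0_gt0 H; apply/cvgrPdist_lt => d d0.
have K1 : 0 < 1 + `|K| by rewrite ltr_pwDl.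
near=> e; rewrite distrC.
have e_pos : 0 < e by near: e; exact: nbhs_right_gt.
have e_lt : e < e0 by near: e; exact: nbhs_right_lt.
apply: le_lt_trans (H e _) _; first by rewrite e_pos.
apply: le_lt_trans (_ : (1 + `|K|) * e < d).
  by rewrite ler_wpM2r ?(ltW e_pos) //; have := ler_norm K; lra.
rewrite mulrC -ltr_pdivlMr //.
by near: e; apply: nbhs_right_lt; rewrite divr_gt0.
Unshelve. all: by end_near. Qed.

Lemma limf_esup_right_lty (f : R -> \bar R) (c e0 : R) : 0 < e0 ->
  (forall e, 0 < e < e0 -> (f e <= c%:E)%E) -> (limf_esup f (0%R : R)^'+ < +oo)%E.
Proof.
move=> e0_gt0 H; apply: (@le_lt_trans _ _ c%:E); last exact: ltry.
rewrite /limf_esup; apply: ereal_inf_le.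
exists (ereal_sup (f @` [set e | 0 < e < e0])).
  exists [set e | 0 < e < e0] => //.
  near=> e; apply/andP; split; near: e; [exact: nbhs_right_gt|exact: nbhs_right_lt].
by apply: ge_ereal_sup => _ [e /H fe <-].
Unshelve. all: by end_near. Qed.

Lemma has_derivative_on_01_is_derive (f g : R -> R) :
  (forall x : R, 0 <= x <= 1 -> is_derive x (1 : R) f (g x)) ->
  has_derivative_on_01 f g.
Proof.
move=> fg x; rewrite in_itv /= => /fg /is_derive1_caratheodory [s [sE cs sx]].
rewrite -sx; apply: cvg_trans (_ : s y @[y --> x] --> s x) => //.
move=> P sP; have : \forall y \near x, P (s y) by exact: sP.
move=> nP.
have H : nbhs x [set y | y != x -> `[0, 1]%classic y -> P ((f y - f x) / (y - x))].
  by apply: filterS nP => y Py yx yI; rewrite sE mulfK // subr_eq0.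
exact: H.
Qed.

(** If r - 1 and w - beta are O(e) and r' is bounded, only the last term of the
    density survives. *)
Lemma polar_density_limit (L a beta K : R) : 0 < L -> 1 <= K -> exists K', forall e r r1 w,
  0 < e -> K * e <= 1 ->
  `|r - 1| <= K * e -> `|r1| <= K -> `|w - beta| <= K * e ->
  `|polar_density L a e r r1 w - L / 2 * (beta - a) ^+ 2| <= K' * e.
Proof.
move=> L0 K1; pose B := `|beta| + K.
exists ((K ^+ 2 + 4 * B ^+ 2) / 2 + 9 / 4 * K ^+ 2
  + L / 2 * ((K + 3 * K * B) * (4 * B + `|beta| + 2 * `|a|))) => e r r1 w e0 Ke rK r1K wK.
have b0 := normr_ge0 beta; have B0 : 0 <= B by rewrite /B; lra.
have K0 : 0 < K by lra.
have wB : `|w| <= B.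
  rewrite -(subrK beta w); apply: le_trans (ler_normD _ _) _; rewrite /B; lra.
have r2b : `|r ^+ 2 - 1| <= 3 * K * e.
  have -> : r ^+ 2 - 1 = (r - 1) * (r + 1) by ring.
  rewrite normrM (_ : 3 * K * e = K * e * 3); last by ring.
  have : `|r + 1| <= 3 by move: rK; rewrite !ler_norml => /andP[? ?]; lra.
  by apply: ler_pM.
have r2 : 0 <= r ^+ 2 <= 4.
  rewrite sqr_ge0 /=; move: rK; rewrite ler_norml => /andP[? ?]; nra.
have sq (u c : R) : `|u| <= c -> u ^+ 2 <= c ^+ 2.
  move=> uc; rewrite -real_normK ?num_real // ler_sqr ?nnegrE //.
  exact: le_trans uc.
have -> : polar_density L a e r r1 w - L / 2 * (beta - a) ^+ 2 =
  e / 2 * (r1 ^+ 2 + r ^+ 2 * w ^+ 2) + 1 / (4 * e) * (r ^+ 2 - 1) ^+ 2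
  + L / 2 * ((r ^+ 2 * w - beta) * (r ^+ 2 * w + beta - 2 * a)).
  by rewrite /polar_density; ring.
have t1 : `|e / 2 * (r1 ^+ 2 + r ^+ 2 * w ^+ 2)| <= (K ^+ 2 + 4 * B ^+ 2) / 2 * e.
  have h1 := sq _ _ r1K; have h2 := sq _ _ wB; have := sqr_ge0 w; have := sqr_ge0 r1.
  move: r2 => /andP[? ?] ? ?.
  have h3 : 0 <= r ^+ 2 * w ^+ 2 <= 4 * B ^+ 2.
    by apply/andP; split; [exact: mulr_ge0|apply: ler_pM].
  move: h3 => /andP[? ?].
  rewrite ger0_norm; last by rewrite mulr_ge0 ?addr_ge0 // divr_ge0 // ltW.
  have -> : (K ^+ 2 + 4 * B ^+ 2) / 2 * e = e / 2 * (K ^+ 2 + 4 * B ^+ 2) by ring.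
  by rewrite ler_wpM2l ?divr_ge0 ?(ltW e0) //; lra.
have t2 : `|1 / (4 * e) * (r ^+ 2 - 1) ^+ 2| <= 9 / 4 * K ^+ 2 * e.
  rewrite ger0_norm; last by rewrite mulr_ge0 ?sqr_ge0 // divr_ge0 // mulr_ge0 // ltW.
  apply: le_trans (_ : 1 / (4 * e) * (3 * K * e) ^+ 2 <= _).
    by apply: ler_wpM2l; [rewrite divr_ge0 // mulr_ge0 // ltW|exact: sq].
  rewrite le_eqVlt; apply/orP; left; apply/eqP; field.
  by rewrite gt_eqF.
have t3 : `|L / 2 * ((r ^+ 2 * w - beta) * (r ^+ 2 * w + beta - 2 * a))|
   <= L / 2 * ((K + 3 * K * B) * (4 * B + `|beta| + 2 * `|a|)) * e.
  have g1 : `|r ^+ 2 * w - beta| <= (K + 3 * K * B) * e.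
    have -> : r ^+ 2 * w - beta = (w - beta) + (r ^+ 2 - 1) * w by ring.
    apply: le_trans (ler_normD _ _) _; rewrite normrM mulrDl; apply: lerD => //.
    by rewrite [leRHS]mulrAC; apply: ler_pM.
  have g2 : `|r ^+ 2 * w + beta - 2 * a| <= 4 * B + `|beta| + 2 * `|a|.
    apply: le_trans (ler_normB _ _) _; rewrite normrM (ger0_norm (ler0n R 2)) lerD2r.
    apply: le_trans (ler_normD _ _) _; rewrite lerD2r normrM.
    move: r2 => /andP[? ?]; rewrite (ger0_norm (sqr_ge0 r)); exact: ler_pM.
  rewrite normrM gtr0_norm ?divr_gt0 //.
  have -> : L / 2 * ((K + 3 * K * B) * (4 * B + `|beta| + 2 * `|a|)) * e
    = L / 2 * ((K + 3 * K * B) * e * (4 * B + `|beta| + 2 * `|a|)) by ring.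
  apply: ler_wpM2l; first by rewrite divr_ge0 // ltW.
  by rewrite normrM; apply: ler_pM.
move: t1 t2 t3; set P := e / 2 * _; set Q := 1 / (4 * e) * _; set T := L / 2 * (_ * (_ - _)).
move=> t1 t2 t3; have := ler_normD (P + Q) T; have := ler_normD P Q; lra.
Qed.

End Limits.

(** * The theorem *)

Lemma winding_cos_sin (R : realType) (M : nat) (alpha : R) :
  cos (2 * pi * M%:R + alpha) = cos alpha /\ sin (2 * pi * M%:R + alpha) = sin alpha.
Proof.
have -> : 2 * pi * M%:R + alpha = alpha + (pi *+ 2) *+ M.
  by rewrite addrC; congr (_ + _); rewrite -[RHS]mulr_natr -[pi *+ 2]mulr_natl.
by split; [exact: (periodicn (@cosD2pi R))|exact: (periodicn (@sinD2pi R))].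
Qed.

Theorem theorem2p3 (R : realType) (L : R) (N : nat) (hL : 0 < L) (hN : (0 < N)%N)
    (M : nat) (hM : (0 < M)%N) (alpha : R) (halpha : 0 <= alpha < 2 * pi) :
  exists2 eps0 : R, 0 < eps0 &
  exists (u : R -> R -> R * R) (theta dtheta : R -> R -> R),
    [/\ forall eps : R, 0 < eps < eps0 ->
          [/\ H1_local_minimizer L N alpha eps (u eps),
              H1_01 (theta eps),
              has_derivative_on_01 (theta eps) (dtheta eps)
            & forall x : R, x \in `[0, 1] ->
                u eps x = (modulus (u eps) x * cos (theta eps x),
                           modulus (u eps) x * sin (theta eps x))],
        (limf_esup (fun eps : R =>
           Linfty_norm_01 (fun x => modulus (u eps) x - 1)%R * (eps^-1)%:E)
           (0%R : R)^'+ < +oo)%E,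
        {uniform `[0, 1],
          dtheta eps @[eps --> 0^'+] --> (fun=> 2 * pi * M%:R + alpha)}
      & energy L N eps (u eps) @[eps --> 0^'+] -->
          L / 2 * (2 * pi * (M%:R - N%:R) + alpha) ^+ 2].
Proof.
pose beta := 2 * pi * M%:R + alpha; pose a := 2 * pi * N%:R : R.
have [K [e1 [K1 e1_gt0 e1_le1 EL]]] := EL_solution a beta hL.
have a0 : 0 <= a by rewrite !mulr_ge0 // pi_ge0.
pose W := `|beta| + K.
have W0 : 0 <= W by rewrite /W addr_ge0 //; lra.
(* e0 <= 1 / Q gives |r - 1| <= 1 / 20 and the two smallness conditions of
   EL_local_minimizer *)
pose Q := 20 * K + 4 * (a * L * W) + 4 * excess_cst L a W ^+ 2 / L.
have aLW : 0 <= a * L * W := mulr_ge0 (mulr_ge0 a0 (ltW hL)) W0.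
have X0 : 0 <= excess_cst L a W ^+ 2 / L by rewrite divr_ge0 ?sqr_ge0 // ltW.
have Q0 : 0 < Q by rewrite /Q; lra.
pose e0 := Num.min e1 Q^-1.
have e0_gt0 : 0 < e0 by rewrite lt_min e1_gt0 invr_gt0.
have small e : 0 < e < e0 -> [/\ 0 < e, e < e1, e <= 1, K * e <= 1 / 20 &
    4 * e * (a * L * W) <= 1 /\ 4 * e * excess_cst L a W ^+ 2 <= L].
  move=> /andP[ep]; rewrite lt_min => /andP[ee1].
  rewrite -[X in _ < X]mul1r ltr_pdivlMr // /Q => eQ.
  have t1 : 0 <= e * (a * L * W) by rewrite mulr_ge0 // ltW.
  have t2 : 0 <= e * (excess_cst L a W ^+ 2 / L) by rewrite mulr_ge0 // ltW.
  have t3 : 0 <= e * K by rewrite mulr_ge0 // ?ltW //; lra.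
  split => //; [lra|lra|split; first by lra].
  have hQ : 4 * (e * (excess_cst L a W ^+ 2 / L)) <= 1 by lra.
  have -> : 4 * e * excess_cst L a W ^+ 2 = 4 * (e * (excess_cst L a W ^+ 2 / L)) * L.
    by field; rewrite gt_eqF.
  by rewrite -[leRHS]mul1r ler_wpM2r // ltW.
pose T : Type := ((R -> R) * (R -> R) * (R -> R) * (R -> R) * (R -> R) * R)%type.
have /choice [F HF] : forall e, exists t : T, 0 < e < e0 ->
    let: (r, r1, r2, th, w, C) := t in EL_data L a beta e K r r1 r2 th w C.
  move=> e.
  have [he|nhe] := pselect (0 < e < e0); last first.
    by exists (fun=> 0, fun=> 0, fun=> 0, fun=> 0, fun=> 0, 0).
  have [ep ee1 _ _ _] := small e he.
  have [|r [r1 [r2 [th [w [C D]]]]]] := EL e; first by rewrite ep.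
  by exists (r, r1, r2, th, w, C).
pose r e := let: (r, _, _, _, _, _) := F e in r.
pose r1 e := let: (_, r1, _, _, _, _) := F e in r1.
pose r2 e := let: (_, _, r2, _, _, _) := F e in r2.
pose th e := let: (_, _, _, th, _, _) := F e in th.
pose w e := let: (_, _, _, _, w, _) := F e in w.
pose C e := let: (_, _, _, _, _, C) := F e in C.
have D e : 0 < e < e0 -> EL_data L a beta e K (r e) (r1 e) (r2 e) (th e) (w e) (C e).
  by move=> /HF; rewrite /r /r1 /r2 /th /w /C; case: (F e) => -[[[[? ?] ?] ?] ?] ?.
pose u e x := (r e x * cos (th e x), r e x * sin (th e x)).
have rb e : 0 < e < e0 -> forall x, 0 <= x <= 1 -> 95 / 100 <= r e x <= 105 / 100.
  move=> he x x01; have := EL_r (D e he) x01; have [_ _ _ Ke _] := small e he.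
  by rewrite ler_norml => /andP[? ?]; apply/andP; split; lra.
have min e : 0 < e < e0 -> H1_local_minimizer L N alpha e (u e) /\
   energy L N e (u e) = \int[@lebesgue_measure R]_(x in `[0, 1])
      polar_density L a e (r e x) (r1 e x) (w e x).
  move=> he; have [ep _ ele1 Ke [s1 s2]] := small e he.
  have [dr dr1 dth cr2 cw _ _ wb rad ang r0 r11 th0 th1] := D e he.
  have [] := @EL_local_minimizer R L W e (C e) beta N (r e) (r1 e) (r2 e) (th e) (w e)
    hL ep ele1 s1 s2 dr dr1 dth cr2 cw (rb e he) _ rad ang r0 r11 th0 th1.
    move=> x x01; rewrite -(subrK beta (w e x)); apply: le_trans (ler_normD _ _) _.
    by have := wb x x01; rewrite /W; lra.
  move=> lm en; split => //.
  have [ca sa] := winding_cos_sin M alpha.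
  by move: lm; rewrite /H1_local_minimizer /admissible /beta ca sa.
have modE e x : 0 < e < e0 -> 0 <= x <= 1 -> modulus (u e) x = r e x.
  move=> he x01; rewrite /modulus /re_part /im_part /= !exprMn -mulrDr cos2Dsin2 mulr1.
  by rewrite sqrtr_sqr ger0_norm //; have /andP[? _] := rb e he x x01; lra.
exists e0 => //; exists u, th, w; split.
- move=> e he; have [lm _] := min e he.
  have [_ _ dth _ cw _ _ _ _ _ _ _ _ _] := D e he.
  split => //.
  + by apply: (ac01_H1 (ac01_C1 dth cw)); exact: L2_cont.
  + exact: has_derivative_on_01_is_derive.
  + by move=> x; rewrite in_itv /= => x01; rewrite modE.
- apply: (limf_esup_right_lty (c := K) e0_gt0) => e he.
  have [ep _ _ _ _] := small e he.
  rewrite lee_pdivrMr //.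
  apply: Linfty_norm_01_le; first by rewrite mulr_ge0 ?(ltW ep) //; lra.
  by move=> x x01; rewrite modE //; exact: (EL_r (D e he)).
- apply: (uniform_rate (K := K) e0_gt0) => e x he x01.
  exact: (EL_w (D e he)).
have [K' HK'] := polar_density_limit a beta hL K1.
have -> : 2 * pi * (M%:R - N%:R) + alpha = beta - a by rewrite /beta /a; ring.
apply: (cvg_rate (K := K') e0_gt0) => e he.
have [ep _ _ Ke _] := small e he.
rewrite (min e he).2.
have [dr dr1 _ _ cw rK r1K wb _ _ _ _ _ _] := D e he.
have cr : cont01 (r e) by apply: cont01_pt => x /dr /is_derive_cont.
have cr1 : cont01 (r1 e) by apply: cont01_pt => x /dr1 /is_derive_cont.
have ip := intg01_cont (@polar_density_cont R L a e _ _ _ cr cr1 cw).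
rewrite -[X in _ - X]int01_cst -RintegralB //; last exact: intg01_cst.
apply: le_trans (le_normr_Rintegral _ _) _ => //; first by apply: intg01B => //; exact: intg01_cst.
rewrite -[leRHS]int01_cst; apply: le_Rintegral => //.
- by apply: intg01_norm; apply: intg01B => //; exact: intg01_cst.
- exact: intg01_cst.
move=> x; rewrite /= in_itv /= => x01.
by apply: HK' => //; [lra|exact: rK|exact: r1K|exact: wb].
Qed.
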